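(* Let $R$ and $S$ be two rings with local units. Then the following conditions are equivalent. (a) There exists a duality between the category of finitely generated unitary left $R$-modules and the category of finitely generated unitary right $S$-modules. (b) $R$ is a left locally finite ring and there exists a Morita duality $R$-$S$-bimodule. (c) $S$ is a right locally finite ring and there exists a Morita duality $R$-$S$-bimodule. In this case, if $U$ is a Morita duality $R$-$S$-bimodule, then the duality functors are isomorphic to $\mathrm{Hom}_R(-,U)S: R\mathrm{mod}\rightarrow\mathrm{mod}S$ and $R\mathrm{Hom}_S(-,U):\mathrm{mod}S\rightarrow R\mathrm{mod}$.
   Context: Rings are associative, not necessarily with identity. A ring $R$ has local units if every finite subset of $R$ is contained in a subring of the form $eRe$ with $e^2=e\in R$. A left $R$-module $M$ is unitary if $RM=M$ (similarly on the right). $R\mathrm{Mod}$ (resp. $\mathrm{Mod}S$) is the category of unitary left $R$-modules (resp. unitary right $S$-modules), and $R\mathrm{mod}$ (resp. $\mathrm{mod}S$) is its full subcategory of finitely generated modules. A duality between additive categories is an additive contravariant functor that is an equivalence, i.e. has an additive contravariant inverse up to natural isomorphism. $R$ is left (resp. right) locally finite if every finitely generated unitary left (resp. right) $R$-module has finite length. Homomorphisms of left modules are written on the right ($fg$ = first $f$, then $g$), those of right modules on the left ($g\circ f$ = first $f$, then $g$). A unitary $R$-$S$-bimodule is a bimodule unitary on both sides. For such $U$, a left $R$-module $X$ and a right $S$-module $Y$: $\mathrm{Hom}_R(X,U)$ is a right $S$-module via $(x)(gs)=((x)g)s$, and $\mathrm{Hom}_R(X,U)S$ is its largest unitary $S$-submodule;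 $\mathrm{Hom}_S(Y,U)$ is a left $R$-module via $(rg)(y)=r\,g(y)$, and $R\mathrm{Hom}_S(Y,U)$ is its largest unitary $R$-submodule. Cogenerating set: a non-empty set $\mathcal U$ of objects of $R\mathrm{Mod}$ such that for every $M$ in $R\mathrm{Mod}$ and every pair of distinct morphisms $f,g:B\to M$ in $R\mathrm{Mod}$ there is a morphism $h:M\to U'$ with $U'\in\mathcal U$ and $fh\ne gh$ (similarly for $\mathrm{Mod}S$). Balanced: a unitary $R$-$S$-bimodule $U$ is balanced if the ring homomorphisms $\mu:S\to\mathrm{End}_R(U)$, $s\mapsto\mu_s$ with $\mu_s:x\mapsto xs$, and $\lambda:R\to\mathrm{End}_S(U)$, $r\mapsto\lambda_r$ with $\lambda_r:x\mapsto rx$, are monomorphisms, $(\mathrm{Im}\mu)(\mathrm{End}_R(U))=\mathrm{Im}\mu$ and $(\mathrm{End}_S(U))(\mathrm{Im}\lambda)=\mathrm{Im}\lambda$, where the left-hand sides are the sets of finite sums of elements $\mu_s f$ (first $\mu_s$, then $f$) with $s\in S$, $f\in\mathrm{End}_R(U)$, and of elements $g\circ\lambda_r$ with $r\in R$, $g\in\mathrm{End}_S(U)$, respectively. A unitary $R$-$S$-bimodule $U$ is a Morita duality bimodule if: (I) for all idempotents $f\in S$ and $e\in R$, $Uf$ is finitely generated and injective in $R\mathrm{Mod}$ and $eU$ is finitely generated and injective in $\mathrm{Mod}S$; (II) $\{Uf\mid f^2=f\in S\}$ and $\{eU\mid e^2=e\in R\}$ are cogenerating sets for $R\mathrm{Mod}$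 and $\mathrm{Mod}S$, respectively; (III) $U$ is balanced.
   Formalization: The last sentence cannot hold for every duality and every U (conjugate dual over ℂ); it is stated as: each Morita duality bimodule U gives a duality isomorphic to the two Hom functors, and each duality is isomorphic to the two Hom functors for some Morita duality bimodule U. *)

(* Defs.v *)
From HB Require Import structures.
From mathcomp Require Import all_boot all_order all_algebra.
From mathcomp Require Import boolp classical_sets.
Set Implicit Arguments.
Unset Strict Implicit.
Unset Printing Implicit Defensive.
Import GRing.Theory.
Local Open Scope classical_set_scope.
Local Open Scope ring_scope.

(** Associative rings, not necessarily with identity. *)

HB.mixin Record Zmodule_isRng R of GRing.Zmodule R := {
  rmul : R -> R -> R;
  rmulA : associative rmul;
  rmulDl : left_distributive rmul +%R;
  rmulDr : right_distributive rmul +%R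
}.

#[short(type="rngType")]
HB.structure Definition Rng := {R of Zmodule_isRng R & GRing.Zmodule R}.

Notation "x ** y" := (rmul x y) (at level 40, left associativity).

(* [R^c] is the opposite ring. A right [R]-module is a left [R^c]-module, the
   element [x r] of the former being [r **: x] in the latter. *)
Section Converse.
Variable R : rngType.
Let mulc (x y : R^c) : R^c := (y : R) ** (x : R).
Let mulcA : associative mulc.
Proof. by move=> x y z; rewrite /mulc rmulA. Qed.
Let mulcDl : left_distributive mulc +%R.
Proof. by move=> x y z; rewrite /mulc rmulDr. Qed.
Let mulcDr : right_distributive mulc +%R.
Proof. by move=> x y z; rewrite /mulc rmulDl. Qed.
HB.instance Definition _ := Zmodule_isRng.Build R^c mulcA mulcDl mulcDr.
End Converse.

Definition idem (R : rngType) (e : R) : Prop := e ** e = e.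

Definition local_units (R : rngType) : Prop :=
  forall s : seq R, exists e : R,
    idem e /\ forall x, x \in s -> exists y, x = e ** y ** e.

(** Modules and homomorphisms. Maps are always applied on the left, so the
    composite "first [f], then [g]" is [lhom_comp g f] for both kinds of
    modules. *)

Record lmod (R : rngType) := LMod {
  lmod_sort :> zmodType;
  lact : R -> lmod_sort -> lmod_sort;
  lactA : forall r s x, lact (r ** s) x = lact r (lact s x);
  lactDl : forall r s x, lact (r + s) x = lact r x + lact s x;
  lactDr : forall r x y, lact r (x + y) = lact r x + lact r y }.

Notation rmod S := (lmod S^c).
Notation "r **: x" := (lact r x) (at level 40).

Record lhom (R : rngType) (M N : lmod R) := LHom {
  lhom_fun :> {additive M -> N};
  lhom_act : forall r x, lhom_fun (r **: x) = r **: lhom_fun x }.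

Lemma lhomP (R : rngType) (M N : lmod R) (f g : lhom M N) : f =1 g -> f = g.
Proof.
case: f g => [f fZ] [g gZ] /= fg.
have E : f = g.
  case: f g fZ gZ fg => [f [[f0]]] [g [[g0]]] /= fZ gZ /funext fg.
  by case: _ / fg g0 gZ => g0 gZ; rewrite (Prop_irrelevance f0 g0).
by case: _ / E gZ => gZ; rewrite (Prop_irrelevance fZ gZ).
Qed.

HB.instance Definition _ (R : rngType) (M N : lmod R) :=
  gen_eqMixin (lhom M N).
HB.instance Definition _ (R : rngType) (M N : lmod R) :=
  gen_choiceMixin (lhom M N).

Lemma lact0 (R : rngType) (M : lmod R) (r : R) : r **: (0 : M) = 0.
Proof. by apply: (addIr (r **: (0 : M))); rewrite -lactDr !add0r. Qed.

Lemma lactN (R : rngType) (M : lmod R) (r : R) (x : M) :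
  r **: (- x) = - (r **: x).
Proof. by apply: (addIr (r **: x)); rewrite -lactDr !addNr lact0. Qed.

Lemma lactB (R : rngType) (M : lmod R) (r : R) (x y : M) :
  r **: (x - y) = r **: x - r **: y.
Proof. by rewrite lactDr lactN. Qed.

Section MkHom.
Variables (R : rngType) (M N : lmod R) (f : M -> N).
Hypothesis fB : zmod_morphism f.
Hypothesis fZ : forall r x, f (r **: x) = r **: f x.
HB.instance Definition _ := GRing.isZmodMorphism.Build M N f fB.
Definition mk_lhom : lhom M N := @LHom R M N f fZ.
End MkHom.

Section HomZmod.
Variables (R : rngType) (M N : lmod R).
Implicit Types f g h : lhom M N.

Fact lhom_zero_additive : zmod_morphism (fun _ : M => 0 : N).
Proof. by move=> x y; rewrite subr0. Qed.
Fact lhom_zero_act (r : R) (x : M) : (0 : N) = r **: (0 : N).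
Proof. by rewrite lact0. Qed.
Definition lhom_zero : lhom M N := mk_lhom lhom_zero_additive lhom_zero_act.

Fact lhom_opp_additive f : zmod_morphism (fun x : M => - f x).
Proof. by move=> x y; rewrite raddfB opprD. Qed.
Fact lhom_opp_act f (r : R) (x : M) : - f (r **: x) = r **: (- f x).
Proof. by rewrite lhom_act lactN. Qed.
Definition lhom_opp f : lhom M N :=
  mk_lhom (lhom_opp_additive f) (lhom_opp_act f).

Fact lhom_add_additive f g : zmod_morphism (fun x : M => f x + g x).
Proof. by move=> x y; rewrite !raddfB opprD addrACA. Qed.
Fact lhom_add_act f g (r : R) (x : M) :
  f (r **: x) + g (r **: x) = r **: (f x + g x).
Proof. by rewrite !lhom_act lactDr. Qed.
Definition lhom_add f g : lhom M N :=
  mk_lhom (lhom_add_additive f g) (lhom_add_act f g).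

Fact lhom_addA : associative lhom_add.
Proof. by move=> f g h; apply/lhomP => x /=; rewrite addrA. Qed.
Fact lhom_addC : commutative lhom_add.
Proof. by move=> f g; apply/lhomP => x /=; rewrite addrC. Qed.
Fact lhom_add0 : left_id lhom_zero lhom_add.
Proof. by move=> f; apply/lhomP => x /=; rewrite add0r. Qed.
Fact lhom_addN : left_inverse lhom_zero lhom_opp lhom_add.
Proof. by move=> f; apply/lhomP => x /=; rewrite addNr. Qed.

HB.instance Definition _ := GRing.isZmodule.Build (lhom M N)
  lhom_addA lhom_addC lhom_add0 lhom_addN.

End HomZmod.

Section HomCategory.
Variable R : rngType.
Implicit Types M N P : lmod R.

Fact lhom_id_additive M : zmod_morphism (fun x : M => x).
Proof. by []. Qed.
Fact lhom_id_act M (r : R) (x : M) : r **: x = r **: x.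
Proof. by []. Qed.
Definition lhom_id M : lhom M M :=
  mk_lhom (@lhom_id_additive M) (@lhom_id_act M).

Fact lhom_comp_additive M N P (g : lhom N P) (f : lhom M N) :
  zmod_morphism (fun x : M => g (f x)).
Proof. by move=> x y; rewrite !raddfB. Qed.
Fact lhom_comp_act M N P (g : lhom N P) (f : lhom M N) (r : R) (x : M) :
  g (f (r **: x)) = r **: g (f x).
Proof. by rewrite !lhom_act. Qed.
Definition lhom_comp M N P (g : lhom N P) (f : lhom M N) : lhom M P :=
  mk_lhom (lhom_comp_additive g f) (lhom_comp_act g f).

Definition lhom_iso M N (f : lhom M N) : Prop :=
  exists g : lhom N M, lhom_comp g f = lhom_id M /\ lhom_comp f g = lhom_id N.

End HomCategory.

(** Submodules. *)

Record submod (R : rngType) (M : lmod R) := SubMod {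
  submod_set :> set M;
  submod0 : submod_set 0;
  submodB : forall x y, submod_set x -> submod_set y -> submod_set (x - y);
  submod_act : forall r x, submod_set x -> submod_set (r **: x) }.

Section SubmodLmod.
Variables (R : rngType) (M : lmod R) (N : submod M).

Definition submod_pred : {pred M} := [pred x | `[< submod_set N x >]].
Fact submod_pred_closed : zmod_closed submod_pred.
Proof.
split=> [|x y]; first by apply/asboolP; exact: submod0.
by move=> /asboolP Nx /asboolP Ny; apply/asboolP; exact: submodB.
Qed.
HB.instance Definition _ :=
  GRing.isZmodClosed.Build M submod_pred submod_pred_closed.

Definition submod_type : Type := {x : M | x \in submod_pred}.
HB.instance Definition _ := SubType.on submod_type.
HB.instance Definition _ := [Choice of submod_type by <:].
HB.instance Definition _ :=
  [SubChoice_isSubZmodule of submod_type by <:].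

Fact submod_lact_subproof (r : R) (x : submod_type) :
  r **: (val x : M) \in submod_pred.
Proof. by apply/asboolP/submod_act; exact/asboolP/(valP x). Qed.
Definition submod_lact (r : R) (x : submod_type) : submod_type :=
  Sub (r **: val x) (submod_lact_subproof r x).

Fact submod_lactA r s x :
  submod_lact (r ** s) x = submod_lact r (submod_lact s x).
Proof. by apply: val_inj; rewrite /= lactA. Qed.
Fact submod_lactDl r s x :
  submod_lact (r + s) x = submod_lact r x + submod_lact s x.
Proof. by apply: val_inj; rewrite /= lactDl. Qed.
Fact submod_lactDr r x y :
  submod_lact r (x + y) = submod_lact r x + submod_lact r y.
Proof. by apply: val_inj; rewrite /= lactDr. Qed.

Definition submod_lmod : lmod R :=
  LMod submod_lactA submod_lactDl submod_lactDr.

End SubmodLmod.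

(* The set [RM] of finite sums of products [r **: x]; for [R] with local units
   it is the largest unitary submodule of [M]. *)
Section UnitaryPart.
Variables (R : rngType) (M : lmod R).

Definition upart_set : set M :=
  [set x | exists s : seq (R * M), x = \sum_(p <- s) p.1 **: p.2].

Fact upart0 : upart_set 0.
Proof. by exists [::]; rewrite big_nil. Qed.
Fact upartB x y : upart_set x -> upart_set y -> upart_set (x - y).
Proof.
move=> [s ->] [t ->]; exists (s ++ [seq (p.1, - p.2) | p <- t]).
rewrite big_cat big_map -sumrN; congr (_ + _).
by apply: eq_bigr => p _; rewrite lactN.
Qed.
Fact upart_act r x : upart_set x -> upart_set (r **: x).
Proof.
move=> [s ->]; exists [seq (r, p.1 **: p.2) | p <- s].
rewrite big_map; elim: s => [|p s IH]; first by rewrite !big_nil lact0.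
by rewrite !big_cons lactDr IH.
Qed.

Definition upart : submod M := SubMod upart0 upartB upart_act.

End UnitaryPart.

Definition unitary (R : rngType) (M : lmod R) : Prop := upart M = setT :> set M.

Definition finitely_generated (R : rngType) (M : lmod R) : Prop :=
  exists s : seq M, forall N : submod M,
    (forall x, x \in s -> submod_set N x) -> N = setT :> set M.

(* [M] has a composition series [c 0 < c 1 < ... < c n]: simplicity of the
   factors means that no submodule lies strictly between [c i] and [c i.+1].
   For [R] with local units and [M] unitary, all submodules are unitary. *)
Definition finite_length (R : rngType) (M : lmod R) : Prop :=
  exists (n : nat) (c : nat -> submod M),
    [/\ c 0%N = [set 0] :> set M, c n = setT :> set M &
     forall i, (i < n)%N ->
       c i `<` c i.+1 /\
       forall N : submod M, c i `<=` N -> N `<=` c i.+1 ->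
         N = c i :> set M \/ N = c i.+1 :> set M].

(** The category of finitely generated unitary modules. *)

Record fgmod (R : rngType) := FGMod {
  fgmod_lmod :> lmod R;
  fgmod_unitary : unitary fgmod_lmod;
  fgmod_fg : finitely_generated fgmod_lmod }.

Definition left_locally_finite (R : rngType) : Prop :=
  forall M : fgmod R, finite_length M.

Definition right_locally_finite (S : rngType) : Prop :=
  left_locally_finite S^c.

Record contrafunctor (A B : rngType) := ContraFunctor {
  cf_obj :> fgmod A -> fgmod B;
  cf_map : forall M N : fgmod A, lhom M N -> lhom (cf_obj N) (cf_obj M);
  cf_id : forall M : fgmod A, cf_map (lhom_id M) = lhom_id (cf_obj M);
  cf_comp : forall (M N P : fgmod A) (f : lhom M N) (g : lhom N P),
    cf_map (lhom_comp g f) = lhom_comp (cf_map f) (cf_map g);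
  cf_add : forall (M N : fgmod A) (f g : lhom M N),
    cf_map (f + g) = cf_map f + cf_map g }.

(* A natural isomorphism from the identity functor to [G F]. *)
Definition unit_iso (A B : rngType)
    (F : contrafunctor A B) (G : contrafunctor B A) : Prop :=
  exists eta : forall M : fgmod A, lhom M (G (F M)),
    (forall M, lhom_iso (eta M)) /\
    (forall (M N : fgmod A) (f : lhom M N),
       lhom_comp (eta N) f = lhom_comp (cf_map G (cf_map F f)) (eta M)).

Definition duality (A B : rngType)
    (F : contrafunctor A B) (G : contrafunctor B A) : Prop :=
  unit_iso F G /\ unit_iso G F.

(** Injective objects and cogenerating sets in the category of unitary
    modules. *)

Definition injective_module (R : rngType) (Q : lmod R) : Prop :=
  unitary Q /\
  forall (M N : lmod R) (i : lhom M N) (f : lhom M Q),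
    unitary M -> unitary N -> injective i ->
    exists g : lhom N Q, lhom_comp g i = f.

Definition cogenerating (R : rngType) (C : lmod R -> Prop) : Prop :=
  [/\ exists X, C X,
      forall X, C X -> unitary X &
      forall (M B : lmod R) (f g : lhom B M),
        unitary M -> unitary B -> f <> g ->
        exists (X : lmod R) (h : lhom M X),
          C X /\ lhom_comp h f <> lhom_comp h g].

(** Bimodules. [biact A B] is an abelian group with two commuting left actions;
    an [R]-[S]-bimodule is thus an element of [biact R S^c]. This presentation
    is symmetric, and every notion having a left and a right version is defined
    for the first action and applied to [U] and to [flip U]. *)

Record biact (A B : rngType) := BiAct {
  biact_left :> lmod A;
  biact_ract : B -> biact_left -> biact_left;
  biact_ractA : forall r s x,
    biact_ract (r ** s) x = biact_ract r (biact_ract s x);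
  biact_ractDl : forall r s x,
    biact_ract (r + s) x = biact_ract r x + biact_ract s x;
  biact_ractDr : forall r x y,
    biact_ract r (x + y) = biact_ract r x + biact_ract r y;
  biact_comm : forall a b x,
    biact_ract b (a **: x) = a **: biact_ract b x }.

Notation bimodule R S := (biact R S^c).

Section Flip.
Variables (A B : rngType) (U : biact A B).

Definition biact_right : lmod B :=
  LMod (@biact_ractA A B U) (@biact_ractDl A B U) (@biact_ractDr A B U).

Definition flip : biact B A :=
  @BiAct B A biact_right (@lact A U) (@lactA A U) (@lactDl A U) (@lactDr A U)
    (fun b a x => esym (@biact_comm A B U a b x)).

End Flip.

Section Bimodules.
Variables (A B : rngType) (U : biact A B).

(* The endomorphism [mu_b] of the [A]-module [U]. *)
Fact mu_additive (b : B) : zmod_morphism (biact_ract b : U -> U).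
Proof. by move=> x y; exact: (@lactB B (biact_right U)). Qed.
Definition mu (b : B) : lhom U U :=
  mk_lhom (mu_additive b) (fun a x => @biact_comm A B U a b x).

(* The [A]-submodule [mu_b (U)]: for an [R]-[S]-bimodule [U] it is [U b] with
   [b : S], and [b U] with [b : R] when taken in [flip U]. *)
Definition mu_img_set (b : B) : set U := range (mu b).
Fact mu_img0 b : mu_img_set b 0.
Proof. by exists 0; rewrite ?raddf0. Qed.
Fact mu_imgB b x y :
  mu_img_set b x -> mu_img_set b y -> mu_img_set b (x - y).
Proof. by move=> [u _ <-] [v _ <-]; exists (u - v); rewrite ?raddfB. Qed.
Fact mu_img_act b (a : A) x : mu_img_set b x -> mu_img_set b (a **: x).
Proof. by move=> [u _ <-]; exists (a **: u); rewrite ?lhom_act. Qed.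
Definition mu_img (b : B) : lmod A :=
  submod_lmod (SubMod (@mu_img0 b) (@mu_imgB b) (@mu_img_act b)).

Definition idem_fg_injective : Prop :=
  forall b : B, idem b ->
    finitely_generated (mu_img b) /\ injective_module (mu_img b).

Definition idem_cogenerating : Prop :=
  cogenerating (fun X => exists2 b : B, idem b & X = mu_img b).

(* [mu] is injective and (Im mu)(End_A(U)) = Im mu. *)
Definition half_balanced : Prop :=
  injective mu /\
  [set h : lhom U U | exists s : seq (B * lhom U U),
     h = \sum_(p <- s) lhom_comp p.2 (mu p.1)] = range mu.

End Bimodules.

Definition morita_duality_bimodule (R S : rngType) (U : bimodule R S) : Prop :=
  [/\ unitary U /\ unitary (flip U),
      idem_fg_injective U /\ idem_fg_injective (flip U),
      idem_cogenerating U /\ idem_cogenerating (flip U) &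
      half_balanced U /\ half_balanced (flip U)].

(** For an [R]-[S]-bimodule [U], [hom_dual U] is Hom_R(-, U)S and
    [hom_dual (flip U)] is R Hom_S(-, U). *)

Section HomDual.
Variables (A B : rngType) (U : biact A B).

Section Object.
Variable M : lmod A.

Definition hom_act (b : B) (g : lhom M U) : lhom M U := lhom_comp (mu U b) g.

Fact hom_actA r s g : hom_act (r ** s) g = hom_act r (hom_act s g).
Proof. by apply/lhomP => x; exact: biact_ractA. Qed.
Fact hom_actDl r s g : hom_act (r + s) g = hom_act r g + hom_act s g.
Proof. by apply/lhomP => x; exact: biact_ractDl. Qed.
Fact hom_actDr r g h : hom_act r (g + h) = hom_act r g + hom_act r h.
Proof. by apply/lhomP => x; exact: biact_ractDr. Qed.

Definition hom_mod : lmod B := LMod hom_actA hom_actDl hom_actDr.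
Definition hom_dual : lmod B := submod_lmod (upart hom_mod).

End Object.

Section Map.
Variables (M N : lmod A) (f : lhom M N).

Let pre (g : hom_mod N) : hom_mod M := lhom_comp g f.

Fact hom_dual_map_subproof (g : hom_dual N) :
  pre (val g) \in submod_pred (upart (hom_mod M)).
Proof.
have /asboolP[s Es] := valP g; apply/asboolP.
exists [seq (p.1, pre p.2) | p <- s]; rewrite Es big_map.
elim: s {Es} => [|p s IH]; first by rewrite !big_nil; apply/lhomP.
by rewrite !big_cons -IH; apply/lhomP.
Qed.
Definition hom_dual_map_fun (g : hom_dual N) : hom_dual M :=
  Sub (pre (val g)) (hom_dual_map_subproof g).
Fact hom_dual_map_additive : zmod_morphism hom_dual_map_fun.
Proof. by move=> g h; apply: val_inj; apply/lhomP. Qed.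
Fact hom_dual_map_act (b : B) g :
  hom_dual_map_fun (b **: g) = b **: hom_dual_map_fun g.
Proof. by apply: val_inj; apply/lhomP. Qed.
Definition hom_dual_map : lhom (hom_dual N) (hom_dual M) :=
  mk_lhom hom_dual_map_additive hom_dual_map_act.

End Map.

(* [F] is naturally isomorphic to [hom_dual]. *)
Definition iso_hom_dual (F : contrafunctor A B) : Prop :=
  exists phi : forall M : fgmod A, lhom (F M) (hom_dual M),
    (forall M, lhom_iso (phi M)) /\
    (forall (M N : fgmod A) (f : lhom M N),
       lhom_comp (phi M) (cf_map F f) = lhom_comp (hom_dual_map f) (phi N)).

End HomDual.

(* Main.v *)
(** Call a bimodule U reflexive if for every finitely generated unitary module
    M the dual Hom(M, U) is again finitely generated and the evaluation of M in
    its double dual is bijective. Everything reduces to: a duality exists iff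
    there is a U reflexive on both sides, iff there is a Morita duality bimodule
    and one of the rings is locally finite.

    From a duality F, U is the direct limit of the modules F(Re) over the
    idempotents e, so that eU = F(Re). It is realized without quotients, by
    recording for u in U all the elements eu of F(Re): writing \hat x for the map
    a |-> a x from Re to M, a pair (w, x) in F(M) x M gives the family of all
    F(\hat x)(w). Sending w to x |-> (w, x) is the isomorphism of F(M) with
    Hom(M, U).

    If U is reflexive, a submodule N of M is its own double annihilator, hence
    the image of the dual of Hom(M, U)/ann(N), which is finitely generated;
    thus M is noetherian, and it is artinian because its dual is noetherian.
    Reflexivity also makes Hom(-, U) exact on finitely generated modules, and
    injectivity in the whole category follows by Zorn's lemma. Conversely, when
    R is locally finite and U is a Morita duality bimodule, injectivity and
    balance show that a homomorphism to U which vanishes where f_1, ..., f_n do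
    is a combination of f_1, ..., f_n with scalar coefficients. *)

Require Import Defs.
From HB Require Import structures.
From mathcomp Require Import all_boot all_algebra.
From mathcomp Require Import boolp classical_sets.
Set Implicit Arguments.
Unset Strict Implicit.
Unset Printing Implicit Defensive.
Import GRing.Theory.
Local Open Scope classical_set_scope.
Local Open Scope ring_scope.

Local Identity Coercion set_to_pred : set >-> Funclass.

(** * Rings with local units and their modules *)

Section RngTheory.
Variable R : rngType.

Lemma rmul0l (x : R) : 0 ** x = 0.
Proof. by apply: (addIr (0 ** x)); rewrite -rmulDl !add0r. Qed.

Lemma rmulNl (x y : R) : (- x) ** y = - (x ** y).
Proof. by apply: (addIr (x ** y)); rewrite -rmulDl !addNr rmul0l. Qed.

Lemma rmulBl (x y z : R) : (x - y) ** z = x ** z - y ** z.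
Proof. by rewrite rmulDl rmulNl. Qed.

Lemma local_unitsP : local_units R -> forall s : seq R, exists2 e : R,
  idem e & forall x, x \in s -> e ** x = x /\ x ** e = x.
Proof.
move=> lu s; have [e [ie eP]] := lu s; exists e => // x /eP[y ->].
by rewrite !rmulA ie -!rmulA ie.
Qed.

Lemma local_units_conv : local_units R -> local_units R^c.
Proof.
move=> lu s; have [e [ie eP]] := lu s; exists e; split=> // x /eP[y ->].
by exists y; rewrite /rmul /= rmulA.
Qed.

(** Bundled so that the modules Re, and later whole families, can be indexed by idempotents. *)
Record idempotent := Idempotent { idem_val :> R; idemP : idem idem_val }.

Lemma idempotentP : local_units R -> forall s : seq R, exists e : idempotent,
  forall x, x \in s -> e ** x = x /\ x ** e = x.
Proof.
by move=> lu s; have [e ie eP] := local_unitsP lu s; exists (Idempotent ie).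
Qed.

End RngTheory.

Section ModuleTheory.
Variable R : rngType.
Implicit Types M N P : lmod R.

Lemma lact0l M (x : M) : (0 : R) **: x = 0.
Proof. by apply: (addIr ((0 : R) **: x)); rewrite -lactDl !add0r. Qed.

Lemma lactNl M (r : R) (x : M) : (- r) **: x = - (r **: x).
Proof. by apply: (addIr (r **: x)); rewrite -lactDl !addNr lact0l. Qed.

Lemma lact_sum M I (s : seq I) (r : R) (f : I -> M) :
  r **: (\sum_(i <- s) f i) = \sum_(i <- s) r **: f i.
Proof.
by elim: s => [|i s IH]; rewrite ?big_nil ?lact0 // !big_cons lactDr IH.
Qed.

Lemma lhom_injP M N (f : lhom M N) : (forall x, f x = 0 -> x = 0) ->
  injective f.
Proof.
by move=> f0 x y fxy; apply/eqP; rewrite -subr_eq0; apply/eqP/f0;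
  rewrite raddfB fxy subrr.
Qed.

Definition lhom_bij M N (f : lhom M N) :=
  injective f /\ forall y, exists x, f x = y.

Lemma lhom_isoP M N (f : lhom M N) : lhom_iso f <-> lhom_bij f.
Proof.
split=> [[g [gf fg]]|[fI /choice[g fg]]].
  split=> [x y fxy|y]; last by exists (g y);
    rewrite -[RHS](congr1 (fun h => lhom_fun h y) fg).
  rewrite -[x](congr1 (fun h => lhom_fun h x) gf) /= fxy.
  exact: (congr1 (fun h => lhom_fun h y) gf).
have gB : zmod_morphism g by move=> x y; apply: fI; rewrite raddfB !fg.
have gZ r x : g (r **: x) = r **: g x by apply: fI; rewrite lhom_act !fg.
exists (mk_lhom gB gZ); split; apply/lhomP => x /=; last by rewrite fg.
by apply: fI; rewrite fg.
Qed.

Lemma lhom_bij_comp M N P (g : lhom N P) (f : lhom M N) :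
  lhom_bij g -> lhom_bij f -> lhom_bij (lhom_comp g f).
Proof.
move=> [gI gS] [fI fS]; split=> [x y /gI/fI //|z].
by have [y <-] := gS z; have [x <-] := fS y; exists x.
Qed.

Lemma lhom_bij_cancel M N P (g : lhom N P) (f : lhom M N) :
  lhom_bij g -> lhom_bij (lhom_comp g f) -> lhom_bij f.
Proof.
move=> [gI gS] [gfI gfS]; split=> [x y fxy|y].
  by apply: gfI; rewrite /= fxy.
by have [x gfx] := gfS (g y); exists x; apply: gI.
Qed.

Definition linv M N (f : lhom M N) (h : lhom_iso f) : lhom N M := sval (cid h).
Lemma linvK M N (f : lhom M N) (h : lhom_iso f) x : linv h (f x) = x.
Proof.
by rewrite /linv; case: cid => g /= [gf _];
  apply: (congr1 (fun h => lhom_fun h x) gf).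
Qed.
Lemma linvKV M N (f : lhom M N) (h : lhom_iso f) x : f (linv h x) = x.
Proof.
by rewrite /linv; case: cid => g /= [_ fg];
  apply: (congr1 (fun h => lhom_fun h x) fg).
Qed.

Lemma submodN M (K : submod M) x : K x -> K (- x).
Proof. by move=> Kx; rewrite -sub0r; apply: submodB => //; exact: submod0. Qed.

Lemma submodD M (K : submod M) x y : K x -> K y -> K (x + y).
Proof.
by move=> Kx Ky; rewrite -[y]opprK; apply: submodB => //; exact: submodN.
Qed.

Lemma submod_sum M (K : submod M) I (s : seq I) (f : I -> M) :
  (forall i, K (f i)) -> K (\sum_(i <- s) f i).
Proof.
move=> Kf; elim: s => [|i s IH]; first by rewrite big_nil; exact: submod0.
by rewrite big_cons; apply: submodD.
Qed.

Lemma submodP M (K L : submod M) : K = L :> set M -> K = L.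
Proof.
by case: K L => [K K0 KB KZ] [L L0 LB LZ] /= E; subst L; congr SubMod;
  exact: Prop_irrelevance.
Qed.

Lemma submod_valP M (K : submod M) (x : submod_lmod K) : K (val x).
Proof. exact/asboolP/(valP x). Qed.

Lemma memP M (K : submod M) x : K x -> x \in submod_pred K.
Proof. by move=> Kx; apply/asboolP. Qed.

Definition to_sub M (K : submod M) x (Kx : K x) : submod_lmod K :=
  Sub x (memP Kx).

Definition incl_hom M (K : submod M) : lhom (submod_lmod K) M :=
  @mk_lhom R (submod_lmod K) M val (fun _ _ => erefl) (fun _ _ => erefl).

Lemma incl_inj M (K : submod M) : injective (incl_hom K).
Proof. exact: val_inj. Qed.

Section Corestrict.
Variables (M N : lmod R) (f : lhom M N) (K : submod N) (fK : forall x, K (f x)).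
Let cor x : submod_lmod K := to_sub (fK x).
Let corB : zmod_morphism cor.
Proof. by move=> x y; apply: val_inj; rewrite /= raddfB. Qed.
Let corZ r x : cor (r **: x) = r **: cor x.
Proof. by apply: val_inj; rewrite /= lhom_act. Qed.
Definition corestrict : lhom M (submod_lmod K) := mk_lhom corB corZ.
End Corestrict.

Section Preimage.
Variables (M N : lmod R) (f : lhom M N) (K : submod N).
Let S : set M := [set x | K (f x)].
Let S0 : S 0. Proof. by rewrite /S /= raddf0; exact: submod0. Qed.
Let SB x y : S x -> S y -> S (x - y).
Proof. by rewrite /S /= raddfB; exact: submodB. Qed.
Let SZ r x : S x -> S (r **: x).
Proof. by rewrite /S /= lhom_act; exact: submod_act. Qed.
Definition preim_sub : submod M := SubMod S0 SB SZ.
End Preimage.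

Section Image.
Variables (M N : lmod R) (f : lhom M N) (K : submod M).
Let S : set N := f @` K.
Let S0 : S 0. Proof. by exists 0; [exact: submod0|rewrite raddf0]. Qed.
Let SB x y : S x -> S y -> S (x - y).
Proof.
by move=> [u Ku <-] [v Kv <-]; exists (u - v); [exact: submodB|rewrite raddfB].
Qed.
Let SZ r x : S x -> S (r **: x).
Proof.
by move=> [u Ku <-]; exists (r **: u); [exact: submod_act|rewrite lhom_act].
Qed.
Definition img_sub : submod N := SubMod S0 SB SZ.
End Image.

Section Lattice.
Variable M : lmod R.

Definition zero_sub : submod M.
Proof.
by apply: (@SubMod R M [set 0]) => [//|x y -> ->|r x ->];
  rewrite /= ?subr0 ?lact0.
Defined.

Definition full_sub : submod M.
Proof. exact: (@SubMod R M setT). Defined.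

Definition cap_sub (K L : submod M) : submod M.
Proof.
apply: (@SubMod R M (K `&` L)); first by split; exact: submod0.
  by move=> x y [? ?] [? ?]; split; apply: submodB.
by move=> r x [? ?]; split; apply: submod_act.
Defined.

Definition add_sub (K L : submod M) : submod M.
Proof.
apply: (@SubMod R M [set x | exists k l, [/\ K k, L l & x = k + l]]).
- by exists 0, 0; rewrite addr0; split=> //; exact: submod0.
- move=> x y [k [l [Kk Ll ->]]] [k' [l' [Kk' Ll' ->]]].
  by exists (k - k'), (l - l'); rewrite opprD addrACA; split=> //;
    apply: submodB.
- move=> r x [k [l [Kk Ll ->]]]; exists (r **: k), (r **: l).
  by rewrite lactDr; split=> //; apply: submod_act.
Defined.

Definition span_sub (s : seq M) : submod M.
Proof.
apply: (@SubMod R M [set x | forall K : submod M, (forall y, y \in s ->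
  K y) -> K x]).
- by move=> K _; exact: submod0.
- by move=> x y sx sy K sK; apply: submodB; [exact: sx|exact: sy].
- by move=> r x sx K sK; apply: submod_act; exact: sx.
Defined.

Definition cyc_sub (x : M) : submod M.
Proof.
apply: (@SubMod R M [set y | exists r, y = r **: x]).
- by exists 0; rewrite lact0l.
- by move=> _ _ [r ->] [s ->]; exists (r - s); rewrite lactDl lactNl.
- by move=> r _ [s ->]; exists (r ** s); rewrite lactA.
Defined.

Lemma mem_span s x : x \in s -> span_sub s x.
Proof. by move=> xs K; apply. Qed.

Lemma sub_span s (K : submod M) : (forall y, y \in s -> K y) ->
  span_sub s `<=` K.
Proof. by move=> sK x; apply. Qed.

End Lattice.

Definition fg_sub M (K : submod M) := exists s : seq M,
  (forall x, x \in s -> K x) /\ K `<=` span_sub s.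

Lemma fg_subP M (K : submod M) :
  finitely_generated (submod_lmod K) <-> fg_sub K.
Proof.
split=> [[s sP]|[s [sK Ks]]].
  exists [seq val x | x <- s]; split=> [_ /mapP[x _ ->]|x Kx L sL];
    first exact: submod_valP.
  have /seteqP[_] := sP (preim_sub (incl_hom K) L) (fun y ys =>
    sL _ (map_f _ ys)).
  by move=> /(_ (to_sub Kx) I).
have [t tE] : exists t : seq (submod_lmod K), [seq val x | x <- t] = s.
  elim: s sK {Ks} => [|x s IH] sK; first by exists [::].
  have [|t <-] := IH; first by move=> y ys; apply: sK; rewrite inE ys orbT.
  have Kx : K x by apply: sK; rewrite mem_head.
  by exists (to_sub Kx :: t).
exists t => L tL; apply/seteqP; split=> // x _.
have [|y Ly] := Ks _ (submod_valP x) (img_sub (incl_hom K) L);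
  last by move/val_inj <-.
by move=> y; rewrite -tE => /mapP[z zt ->]; exists z => //; exact: tL.
Qed.

Lemma fgP M : finitely_generated M <-> exists s : seq M, forall x, span_sub s x.
Proof.
split=> [[s sP]|[s sP]]; exists s.
  by have := sP (span_sub s) (@mem_span M s) => /seteqP[_] sT x; exact: sT.
by move=> N sN; apply/seteqP; split=> // x _; exact: sP.
Qed.

Lemma fg_full M : finitely_generated M -> fg_sub (full_sub M).
Proof. by move/fgP=> [s sP]; exists s; split. Qed.

Lemma fg_surj M N (f : lhom M N) : finitely_generated M ->
  (forall y, exists x, f x = y) -> finitely_generated N.
Proof.
move=> /fgP[s sP] fS; apply/fgP; exists [seq f x | x <- s] => y.
have [x <-] := fS y; apply: (sP x (preim_sub f (span_sub _))) => z zs.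
exact/mem_span/map_f.
Qed.

Lemma fg_img M N (f : lhom M N) (K : submod M) : fg_sub K ->
  fg_sub (img_sub f K).
Proof.
move=> [s [sK Ks]]; exists [seq f x | x <- s]; split.
  by move=> _ /mapP[x xs ->]; exists x => //; exact: sK.
move=> _ [x Kx <-]; apply: (Ks x Kx (preim_sub f (span_sub _))) => z zs.
exact/mem_span/map_f.
Qed.

Lemma fg_sub_inj M N (f : lhom M N) : injective f ->
  fg_sub (img_sub f (full_sub M)) ->
  finitely_generated M.
Proof.
move=> fI /fg_subP fg; have fK x : img_sub f (full_sub M) (f x) by exists x.
have [|g [_ fg1]] := (lhom_isoP (corestrict fK)).2.
  split=> [x y /(congr1 val)/fI //|y]; have [x _ xy] := submod_valP y.
  by exists x; apply: val_inj.
apply: (@fg_surj _ _ g fg) => x; exists (corestrict fK x).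
move: (congr1 (fun h => lhom_fun h (corestrict fK x)) fg1) =>
  /= /(congr1 val) /=.
exact: fI.
Qed.

Lemma lhom_eq_span M N (f g : lhom M N) s :
  (forall x, span_sub s x) -> (forall x, x \in s -> f x = g x) -> f = g.
Proof.
move=> sT fg; apply/lhomP => x; apply/eqP; rewrite -subr_eq0; apply/eqP.
by apply: (sT x (preim_sub (f - g) (zero_sub N))) => y /fg /= ->;
  rewrite /zero_sub /= subrr.
Qed.

Lemma fg_cyc M (x : M) : cyc_sub x x -> fg_sub (cyc_sub x).
Proof.
move=> cx; exists [:: x]; split=> [y|_ [r ->]]; first by rewrite inE => /eqP ->.
by apply: submod_act; apply: mem_span; rewrite mem_head.
Qed.

Lemma unitary_seq M : local_units R -> unitary M -> forall s : seq M,
  exists e : idempotent R, forall x, x \in s -> e **: x = x.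
Proof.
move=> lu uM s.
(* The list [t] collects the left factors when the elements of [s] are written as sums of products;
   any [e] that fixes them fixes [s]. *)
suff [t tP] : exists t : seq R, forall e : R, (forall r, r \in t ->
  e ** r = r) ->
    forall x, x \in s -> e **: x = x.
  have [e eP] := idempotentP lu t; exists e; apply: tP.
  by move=> r /eP[].
elim: s => [|x s [t tP]]; first by exists [::].
have [p px] : upart M x by rewrite uM.
exists ([seq q.1 | q <- p] ++ t) => e et y; rewrite inE => /orP[/eqP ->|ys].
  rewrite px lact_sum; apply: eq_big_seq => q qp.
  by rewrite -lactA et // mem_cat map_f.
by apply: tP => // r rt; apply: et; rewrite mem_cat rt orbT.
Qed.

Lemma unitaryP M : (forall x : M, exists e : R, e **: x = x) -> unitary M.
Proof.
move=> h; apply/seteqP; split=> // x _; have [e ex] := h x.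
by exists [:: (e, x)]; rewrite big_seq1.
Qed.

Lemma unitary1 M : local_units R -> unitary M ->
  forall x : M, exists e : idempotent R, e **: x = x.
Proof.
by move=> lu uM x; have [e eP] := unitary_seq lu uM [:: x]; exists e;
  rewrite eP ?mem_head.
Qed.

Lemma unitary2 M : local_units R -> unitary M ->
  forall x y : M, exists e : idempotent R, e **: x = x /\ e **: y = y.
Proof.
move=> lu uM x y; have [e eP] := unitary_seq lu uM [:: x; y].
by exists e; split; apply: eP; rewrite !inE eqxx ?orbT.
Qed.

Lemma unitary_sub M (K : submod M) : local_units R -> unitary M ->
  unitary (submod_lmod K).
Proof.
move=> lu uM; apply: unitaryP => x; have [e ex] := unitary1 lu uM (val x).
by exists e; apply: val_inj.
Qed.

Lemma unitary_surj M N (f : lhom M N) : local_units R -> unitary M ->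
  (forall y, exists x, f x = y) -> unitary N.
Proof.
move=> lu uM fS; apply: unitaryP => y; have [x <-] := fS y.
by have [e ex] := unitary1 lu uM x; exists e; rewrite -lhom_act ex.
Qed.

Lemma upart_eq M (e : R) (x : M) : e **: x = x -> upart M x.
Proof. by move=> ex; exists [:: (e, x)]; rewrite big_seq1. Qed.

Lemma unitary_upart M : local_units R -> unitary (submod_lmod (upart M)).
Proof.
move=> lu; apply: unitaryP => x; have [s sx] := submod_valP x.
have [e eP] := idempotentP lu [seq q.1 | q <- s]; exists e; apply: val_inj.
rewrite /= sx lact_sum; apply: eq_big_seq => q qs.
by rewrite -lactA (eP _ (map_f _ qs)).1.
Qed.

Lemma cyc_id M (x : M) : local_units R -> unitary M -> cyc_sub x x.
Proof. by move=> lu uM; have [e ex] := unitary1 lu uM x; exists e. Qed.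

End ModuleTheory.

(** * Quotients, powers and the projective modules Re *)

Section QuotientModule.
Variables (R : rngType) (M : lmod R) (K : submod M).

Let Q : zmodType := Quotient.quot (submod_pred K).
Let pi (x : M) : Q := (\pi_(Quotient.quot (submod_pred K)) x)%qT.

Let pi_eq x y : pi x = pi y <-> K (x - y).
Proof.
split=> [/eqP|Kxy]; first by rewrite -Quotient.idealrBE => /asboolP.
by apply/eqP; rewrite -Quotient.idealrBE; exact/asboolP.
Qed.
Let piB : {morph pi : x y / x - y}.
Proof. exact: raddfB. Qed.
Let piD : {morph pi : x y / x + y}.
Proof. exact: raddfD. Qed.
Let repr_pi (x : Q) : pi (repr x) = x.
Proof. exact: reprK. Qed.

Let qact (r : R) (x : Q) : Q := pi (r **: (repr x : M)).
Let qactE r x : qact r (pi x) = pi (r **: x).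
Proof. by apply/pi_eq; rewrite -lactB; apply: submod_act; apply/pi_eq. Qed.

Let qactA r s x : qact (r ** s) x = qact r (qact s x).
Proof. by rewrite -[x]repr_pi !qactE lactA. Qed.
Let qactDl r s x : qact (r + s) x = qact r x + qact s x.
Proof. by rewrite -[x]repr_pi !qactE lactDl piD. Qed.
Let qactDr r x y : qact r (x + y) = qact r x + qact r y.
Proof. by rewrite -[x]repr_pi -[y]repr_pi -piD !qactE lactDr piD. Qed.

Definition quot_mod : lmod R := LMod qactA qactDl qactDr.

Let piZ r x : pi (r **: x) = (r **: (pi x : quot_mod)).
Proof. by rewrite /= qactE. Qed.

Definition quot_map : lhom M quot_mod := @mk_lhom R M quot_mod pi piB piZ.

Lemma quot_map_surj (y : quot_mod) : exists x, quot_map x = y.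
Proof. by exists (repr y); exact: repr_pi. Qed.

Lemma quot_map0 x : quot_map x = 0 <-> K x.
Proof. by rewrite -(raddf0 quot_map) /= pi_eq subr0. Qed.

Lemma quot_lift (N : lmod R) (f : lhom M N) : (forall x, K x -> f x = 0) ->
  exists k : lhom quot_mod N, forall x, k (quot_map x) = f x.
Proof.
move=> f0; have /choice[s sP] := quot_map_surj.
have f_eq x y : quot_map x = quot_map y -> f x = f y.
  move=> xy; apply/eqP; rewrite -subr_eq0 -raddfB; apply/eqP/f0/quot_map0.
  by rewrite raddfB xy subrr.
have kB : zmod_morphism (fun y => f (s y)).
  by move=> x y; rewrite -raddfB; apply: f_eq; rewrite raddfB !sP.
have kZ r y : f (s (r **: y)) = r **: f (s y).
  by rewrite -lhom_act; apply: f_eq; rewrite lhom_act !sP.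
by exists (mk_lhom kB kZ) => x; apply: f_eq; rewrite sP.
Qed.

End QuotientModule.

Section Power.
Variables (R : rngType) (M : lmod R) (n : nat).

Let T : zmodType := {ffun 'I_n -> M}.
Let pact (r : R) (x : T) : T := [ffun i => r **: x i].
Let pactA r s x : pact (r ** s) x = pact r (pact s x).
Proof. by apply/ffunP => i; rewrite !ffunE lactA. Qed.
Let pactDl r s x : pact (r + s) x = pact r x + pact s x.
Proof. by apply/ffunP => i; rewrite !ffunE lactDl. Qed.
Let pactDr r x y : pact r (x + y) = pact r x + pact r y.
Proof. by apply/ffunP => i; rewrite !ffunE lactDr. Qed.
Definition power_mod : lmod R := LMod pactA pactDl pactDr.

Let injB i : zmod_morphism (fun x : M => [ffun j =>
  if j == i then x else 0] : power_mod).
Proof.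
by move=> x y; apply/ffunP => j; rewrite !ffunE; case: ifP => // _;
  rewrite subr0.
Qed.
Let injZ i r (x : M) : ([ffun j => if j == i then r **: x else 0] : power_mod)
  = r **: ([ffun j => if j == i then x else 0] : power_mod).
Proof.
by apply/ffunP => j; rewrite !ffunE; case: ifP => // _; rewrite lact0.
Qed.
Definition pow_inj i : lhom M power_mod := mk_lhom (@injB i) (@injZ i).

Lemma pow_sum (x : power_mod) : x = \sum_i pow_inj i (x i).
Proof.
apply/ffunP => j;
  rewrite sum_ffunE (bigD1 j) //= !ffunE eqxx big1 ?addr0 // => i ij.
by rewrite ffunE eq_sym (negPf ij).
Qed.

Lemma unitary_power : local_units R -> unitary M -> unitary power_mod.
Proof.
move=> lu uM; apply: unitaryP => x.
have [e eP] := unitary_seq lu uM [seq x i | i <- enum 'I_n].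
by exists e; apply/ffunP => i; rewrite ffunE eP // map_f ?mem_enum.
Qed.

Lemma fg_power : finitely_generated M -> finitely_generated power_mod.
Proof.
move=> /fgP[s sP]; apply/fgP.
exists [seq pow_inj i x | i <- enum 'I_n, x <- s] => x; rewrite [x]pow_sum.
apply: submod_sum => i;
  apply: (sP (x i) (preim_sub (pow_inj i) (span_sub _))) => y ys.
by apply: mem_span; apply/allpairsP; exists (i, y); rewrite mem_enum.
Qed.

Section Tuple.
Variables (N : lmod R) (f : 'I_n -> lhom N M).
Let tB : zmod_morphism (fun x : N => [ffun i => f i x] : power_mod).
Proof. by move=> x y; apply/ffunP => i; rewrite !ffunE raddfB. Qed.
Let tZ r (x : N) : ([ffun i =>
  f i (r **: x)] : power_mod) = r **: ([ffun i => f i x] : power_mod).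
Proof. by apply/ffunP => i; rewrite !ffunE lhom_act. Qed.
Definition pow_tuple : lhom N power_mod := mk_lhom tB tZ.
End Tuple.

End Power.

Section PrincipalProjective.
Variable R : rngType.

Definition regular_mod : lmod R :=
  @LMod R R (@rmul R) (fun r s x => esym (rmulA r s x)) (@rmulDl R) (@rmulDr R).

Section Object.
Variable e : idempotent R.
Let S : set regular_mod := [set x | (x : R) ** e = x].
Let S0 : S 0. Proof. exact: rmul0l. Qed.
Let SB x y : S x -> S y -> S (x - y).
Proof. by rewrite /S /= rmulBl => -> ->. Qed.
Let SZ r x : S x -> S (r **: x).
Proof. by rewrite /S /= -rmulA => ->. Qed.
Definition left_ideal : submod regular_mod := SubMod S0 SB SZ.

Definition left_elt (a : R) : submod_lmod left_ideal.
Proof. by apply: (@to_sub _ _ left_ideal (a ** e));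
  rewrite /left_ideal /= /S /= -rmulA idemP. Defined.
Definition left_gen := left_elt e.

Lemma left_ideal_valP (a : submod_lmod left_ideal) : (val a : R) ** e = val a.
Proof. exact: (submod_valP a). Qed.

Lemma left_gen_act (a : submod_lmod left_ideal) : (val a : R) **: left_gen = a.
Proof. by apply: val_inj; rewrite /= idemP left_ideal_valP. Qed.

Hypothesis lu : local_units R.
Lemma left_ideal_unitary : unitary (submod_lmod left_ideal).
Proof.
apply: unitaryP => x; have [f fP] := idempotentP lu [:: (val x : R)].
by exists f; apply: val_inj; rewrite /= (fP _ (mem_head _ _)).1.
Qed.
Lemma left_ideal_fg : finitely_generated (submod_lmod left_ideal).
Proof.
apply/fgP; exists [:: left_gen] => x; rewrite -(left_gen_act x).
by apply: submod_act; apply: mem_span; rewrite mem_head.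
Qed.
Definition left_proj : fgmod R := FGMod left_ideal_unitary left_ideal_fg.
End Object.

Hypothesis lu : local_units R.
Section Point.
Variables (e : idempotent R) (M : lmod R).
Let pB (x : M) : zmod_morphism (fun a : left_proj e lu => (val a : R) **: x).
Proof. by move=> a b; rewrite raddfB /= lactDl lactNl. Qed.
Let pZ (x : M) r (a : left_proj e lu) : (val (r **: a) :
  R) **: x = r **: ((val a : R) **: x).
Proof. by rewrite /= lactA. Qed.
Definition point_hom x : lhom (left_proj e lu) M := mk_lhom (@pB x) (@pZ x).

Lemma point_gen (x : M) : point_hom x (left_gen e) = e **: x.
Proof. by rewrite /= idemP. Qed.

(** With [point_gen], this identifies Hom(Re, M) with eM through the value at the generator e. *)
Lemma pointK (t : lhom (left_proj e lu) M) : point_hom (t (left_gen e)) = t.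
Proof. by apply/lhomP => a; rewrite /= -lhom_act left_gen_act. Qed.

Lemma pointD (x y : M) : point_hom (x + y) = point_hom x + point_hom y.
Proof. by apply/lhomP => a /=; rewrite lactDr. Qed.

Lemma pointB (x y : M) : point_hom (x - y) = point_hom x - point_hom y.
Proof. by apply/lhomP => a /=; rewrite lactB. Qed.
End Point.

Lemma comp_point (e : idempotent R) (M N : lmod R) (t : lhom M N) x :
  lhom_comp t (point_hom e x) = point_hom e (t x).
Proof. by apply/lhomP => a; rewrite /= lhom_act. Qed.

End PrincipalProjective.

Section FgModules.
Variables (R : rngType) (lu : local_units R) (M : fgmod R) (K : submod M).

Definition sub_fgmod (fgK : fg_sub K) : fgmod R :=
  FGMod (@unitary_sub _ _ K lu (fgmod_unitary M)) ((fg_subP K).2 fgK).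

Definition quot_fgmod : fgmod R :=
  FGMod (unitary_surj lu (fgmod_unitary M) (@quot_map_surj _ _ K))
    (fg_surj (fgmod_fg M) (@quot_map_surj _ _ K)).
End FgModules.

(** * Duals and reflexive bimodules *)

Lemma upart_hom (R : rngType) (M N : lmod R) (f : lhom M N) x :
  upart M x -> upart N (f x).
Proof.
move=> [s ->]; exists [seq (p.1, f p.2) | p <- s].
by rewrite big_map raddf_sum; apply: eq_bigr => p _; rewrite lhom_act.
Qed.

(** Flipping twice keeps all operations and changes only the proof that they commute. *)
Lemma flip_flip (A B : rngType) (U : biact A B) : flip (flip U) = U.
Proof.
case: U => [[V a aA aDl aDr] b bA bDl bDr c]; rewrite /flip /biact_right /=.
by congr BiAct; exact: Prop_irrelevance.
Qed.

Section Evaluation.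
Variables (A B : rngType) (U : biact A B) (M : lmod A).

Definition ev_at (x : M) : lhom (hom_dual U M) (flip U) :=
  @mk_lhom B (hom_dual U M) (flip U) (fun g => (val g : lhom M U) x)
    (fun _ _ => erefl) (fun _ _ => erefl).

Let evB : zmod_morphism (ev_at : M -> hom_mod (flip U) (hom_dual U M)).
Proof. by move=> x y; apply/lhomP => g; exact: raddfB. Qed.
Let evZ r x : ev_at (r **: x) = r **: (ev_at x :
  hom_mod (flip U) (hom_dual U M)).
Proof. by apply/lhomP => g; exact: (lhom_act (val g : lhom M U)). Qed.
Definition ev_hom : lhom M (hom_mod (flip U) (hom_dual U M)) := mk_lhom evB evZ.

Hypothesis uM : unitary M.
Let ev_upart x : upart (hom_mod (flip U) (hom_dual U M)) (ev_hom x).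
Proof. by apply: upart_hom; rewrite uM. Qed.

Definition ev : lhom M (hom_dual (flip U) (hom_dual U M)) :=
  corestrict ev_upart.
End Evaluation.

Section DualElements.
Variables (A B : rngType) (U : biact A B).
Hypotheses (luB : local_units B) (uU : unitary (flip U)).

(** The images of finitely many generators are fixed by a common idempotent. Hence Hom(M, U) is
    unitary for such M, and [to_dual] can view every homomorphism to U as an element of the dual. *)
Lemma hom_absorb (M : lmod A) (g : lhom M U) : finitely_generated M ->
  exists b : idempotent B, forall x, biact_ract b (g x) = g x.
Proof.
move=> /fgP[s sP];
  have [b bP] := unitary_seq luB uU [seq (g x : flip U) | x <- s].
exists b => x; have E : lhom_comp (mu U b) g = g.
  by apply: (lhom_eq_span sP) => y ys; apply: bP; rewrite map_f.
exact: (congr1 (fun h => lhom_fun h x) E).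
Qed.

Lemma hom_upart (M : lmod A) (g : lhom M U) : finitely_generated M ->
  upart (hom_mod U M) g.
Proof.
by move=> /(hom_absorb g)[b bP]; apply: (upart_eq (e := b)); apply/lhomP.
Qed.

Definition to_dual (M : fgmod A) (g : lhom M U) : hom_dual U M :=
  to_sub (hom_upart g (fgmod_fg M)).

End DualElements.

Definition reflexive_biact (A B : rngType) (U : biact A B) :=
  forall M : fgmod A,
  finitely_generated (hom_dual U M) /\ lhom_bij (ev U (fgmod_unitary M)).

Section DualFunctor.
Variables (A B : rngType) (luB : local_units B) (U : biact A B).
Hypothesis fgU : forall M : fgmod A, finitely_generated (hom_dual U M).

Definition dual_obj (M : fgmod A) : fgmod B :=
  FGMod (@unitary_upart _ (hom_mod U M) luB) (fgU M).

Definition dual_functor : contrafunctor A B.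
Proof.
apply: (@ContraFunctor A B dual_obj (fun M N f => hom_dual_map U f)).
- by move=> M; apply/lhomP => g; apply: val_inj; apply/lhomP.
- by move=> M N P f g; apply/lhomP => h; apply: val_inj; apply/lhomP.
- by move=> M N f g; apply/lhomP => h; apply: val_inj; apply/lhomP => x;
    exact: raddfD.
Defined.

Lemma dual_functor_iso : iso_hom_dual U dual_functor.
Proof.
exists (fun M => lhom_id (hom_dual U M)); split; last by move=> M N f;
  apply/lhomP.
by move=> M; exists (lhom_id _); split; apply/lhomP.
Qed.
End DualFunctor.

(* [V] is only propositionally equal to [flip U]: the case of [flip U] and [U]
   uses [flip_flip]. *)
Lemma dual_unit_iso (A B : rngType) (luA : local_units A) (luB : local_units B)
  (U : biact A B) (V : biact B A) fgU fgV : V = flip U -> reflexive_biact U ->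
  unit_iso (@dual_functor A B luB U fgU) (@dual_functor B A luA V fgV).
Proof.
move=> VU; subst V => rU; exists (fun M => ev U (fgmod_unitary M)); split.
  by move=> M; apply/lhom_isoP; case: (rU M).
move=> M N f; apply/lhomP => x; apply: val_inj; apply/lhomP => g.
by [].
Qed.

Theorem reflexive_duality (A B : rngType) (U : biact A B) : local_units A ->
  local_units B -> reflexive_biact U -> reflexive_biact (flip U) ->
  exists (F : contrafunctor A B) (G : contrafunctor B A),
    [/\ duality F G, iso_hom_dual U F & iso_hom_dual (flip U) G].
Proof.
move=> luA luB rU rfU.
exists (dual_functor luB (fun M => (rU M).1)), (dual_functor luA (fun M =>
  (rfU M).1)).
split; [split|exact: dual_functor_iso|exact: dual_functor_iso].
  exact: dual_unit_iso.
by apply: dual_unit_iso => //; rewrite flip_flip.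
Qed.

(** * Annihilators and consequences of reflexivity *)

Section Annihilator.
Variables (A B : rngType) (U : biact A B) (M : lmod A).

Definition annih (N : submod M) : submod (hom_dual U M).
Proof.
apply: (@SubMod B (hom_dual U M) [set w | forall y, N y ->
  (val w : lhom M U) y = 0]).
- by [].
- by move=> v w v0 w0 y Ny; rewrite /= v0 // w0 // subr0.
- by move=> b w w0 y Ny; rewrite /= w0 //; exact: (@lact0 B (flip U)).
Defined.

End Annihilator.

Section Separation.
Variables (A B : rngType) (luA : local_units A) (luB : local_units B).
Variables (U : biact A B) (ufU : unitary (flip U)).
Hypothesis rU : reflexive_biact U.

(** Evaluation is injective on the finitely generated quotient of M by N, where x is non-zero; a
    functional that detects x there is pulled back to M. *)
Lemma separation (M : fgmod A) (N : submod M) x : ~ N x ->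
  exists g : lhom M U, (forall y, N y -> g y = 0) /\ g x <> 0.
Proof.
move=> nNx; apply: contrapT => /forallNP ng; apply: nNx.
apply/quot_map0/((rU (quot_fgmod luA N)).2.1); rewrite raddf0; apply: val_inj.
apply/lhomP => g; apply: contrapT => gx;
  apply: (ng (lhom_comp (val g) (quot_map N))).
by split=> // y /quot_map0 Ny; rewrite /= Ny raddf0.
Qed.

Lemma annih_le (M : fgmod A) (K L : submod M) :
  annih U L `<=` annih U K -> K `<=` L.
Proof.
move=> LK x Kx; apply: contrapT => /separation[g [gL gx]]; apply: gx.
exact: (LK (to_dual luB ufU g) gL).
Qed.

(** For an idempotent e with ae = a, every homomorphism g from Ae to U sends a to a g(e) = 0, and
    evaluation on Ae is injective. *)
Lemma reflexive_faithful (a : A) : (forall u : U, a **: u = 0) -> a = 0.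
Proof.
move=> a0; have [e eP] := idempotentP luA [:: a].
have [_ ae] := eP a (mem_head _ _).
suff : left_elt e a = 0 by move=> /(congr1 val) /=; rewrite ae.
apply: ((rU (left_proj e luA)).2.1); rewrite raddf0; apply: val_inj;
  apply/lhomP => g /=.
by rewrite -[left_elt e a]left_gen_act lhom_act /= ae a0.
Qed.

End Separation.

Section ReflexiveBimodule.
Variables (A B : rngType) (luA : local_units A) (luB : local_units B).
Variables (U : biact A B) (uU : unitary U) (ufU : unitary (flip U)).
Hypotheses (rU : reflexive_biact U) (rfU : reflexive_biact (flip U)).

Let uffU : unitary (flip (flip U)).
Proof. by rewrite flip_flip. Qed.

Let D (M : fgmod A) : fgmod B := dual_obj luB (fun M => (rU M).1) M.

Lemma reflexive_fg_sub (M : fgmod A) (N : submod M) : fg_sub N.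
Proof.
pose Q := quot_fgmod (M := D M) luB (annih U N).
pose q : lhom (D M) Q := quot_map (annih U N).
have evi := (lhom_isoP _).2 (rU M).2.
(* The transpose of [q] followed by the inverse of evaluation. Its image is the double annihilator
   of N, which is N by separation. *)
pose t := lhom_comp (linv evi) (hom_dual_map (flip U) q).
have tP k (w : hom_dual U M) :
    (val w : lhom M U) (t k) = (val k : lhom Q (flip U)) (q w).
  have := linvKV evi (hom_dual_map (flip U) q k).
  by move=> /(congr1 val) /(congr1 (fun h => lhom_fun h w)).
have -> : N = img_sub t (full_sub _).
  apply: submodP; apply/seteqP; split=> [y Ny|_ [k _ <-]].
    (* Evaluation at an element of N vanishes on the annihilator, so it factors through the
       quotient. *)
    have [|k kE] :=
      @quot_lift _ _ (annih U N) _ (ev_at U y : lhom (D M) (flip U)).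
      by move=> w; apply.
    exists (to_dual luA uffU (k : lhom Q (flip U))) => //.
    rewrite -[RHS](linvK evi); congr (linv evi _); apply: val_inj.
    by apply/lhomP => w; exact: kE.
  apply: contrapT => /(separation luA rU)[g [gN]]; apply.
  have -> : g = val (to_dual luB ufU g) by [].
  by rewrite tP (quot_map0 _ _).2 ?raddf0.
by apply/fg_img/fg_full; case: (rfU Q).
Qed.

(** Otherwise separation in the dual of M yields a functional that vanishes on all restrictions of
    homomorphisms from N but not at f. By reflexivity it is evaluation at some x; then every
    homomorphism from N to U kills i(x), so x = 0, a contradiction. *)
Lemma reflexive_extension (M N : fgmod A) (i : lhom M N) (f : lhom M U) :
  injective i -> exists g : lhom N U, lhom_comp g i = f.
Proof.
move=> iI; pose X := img_sub (hom_dual_map U i) (full_sub _).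
have [[g _ gf]|] := pselect (X (to_dual luB ufU f)).
  by exists (val g); exact: (congr1 val gf).
move=> /(@separation _ _ luB _ rfU (D M))[k [kX kf]]; case: kf.
have [x xk] := (rU M).2.2 (to_dual luA uffU (k : lhom (D M) (flip U))).
have kE w : k w = (val w : lhom M U) x.
  by have := congr1 val xk => /(congr1 (fun h => lhom_fun h w)).
rewrite kE; suff -> : x = 0 by exact: raddf0.
apply: iI; rewrite raddf0; apply: (rU N).2.1; rewrite raddf0; apply: val_inj.
by apply/lhomP => g; have := kX (hom_dual_map U i g); rewrite kE; apply;
  exists g.
Qed.

Definition mu_sub (b : B) : submod U :=
  SubMod (@mu_img0 A B U b) (@mu_imgB A B U b) (@mu_img_act A B U b).

Lemma mu_subP (b : B) (ib : idem b) x : mu_sub b x <-> biact_ract b x = x.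
Proof. by split=> [[u _ <-]|<-]; [rewrite /= -biact_ractA ib|exists x]. Qed.

(** Evaluation at the generator maps the dual of the cyclic projective Bb onto Ub, and that dual is
    finitely generated by reflexivity of [flip U]. *)
Lemma mu_img_fg (b : B) : idem b -> finitely_generated (mu_img U b).
Proof.
move=> ib; pose e := Idempotent ib; pose P := left_proj e luB.
pose t : lhom (hom_dual (flip U) P) U :=
  @mk_lhom A (hom_dual (flip U) P) U (fun g =>
    (val g : lhom P (flip U)) (left_gen e))
    (fun _ _ => erefl) (fun _ _ => erefl).
have tb g : mu_sub b (t g).
  apply/mu_subP => //.
  apply: etrans (esym (lhom_act (val g : lhom P (flip U)) b (left_gen e))) _.
  by congr (lhom_fun _ _); apply: val_inj => /=; rewrite rmulA ib.
apply: (@fg_surj _ _ _ (corestrict tb)); first by case: (rfU P).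
move=> u; exists (to_dual luA uffU (point_hom luB e (val u : flip U)));
  apply: val_inj => /=.
by rewrite ib; apply/mu_subP => //; exact: submod_valP.
Qed.

Lemma reflexive_half_balanced : half_balanced (flip U).
Proof.
split=> [a a' aa'|].
  apply/eqP; rewrite -subr_eq0; apply/eqP/(reflexive_faithful luA rU) => u.
  rewrite lactDl lactNl; apply/eqP; rewrite subr_eq0; apply/eqP.
  exact: (congr1 (fun h : lhom (flip U) (flip U) => h u) aa').
apply/seteqP; split=> [_ [s ->]|_ [a _ <-]]; last first.
  by exists [:: (a, lhom_id _)]; rewrite big_seq1; apply/lhomP.
elim: s => [|[a h] s [c _ cE]]; rewrite ?big_nil ?big_cons.
  by exists 0 => //; apply/lhomP => u; exact: (@lact0l A U).
suff [d dE] : exists d, forall u : U, h (a **: u) = d **: u.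
  exists (d + c) => //; rewrite -cE; apply/lhomP => u /=; rewrite dE.
  exact: (@lactDl A U).
have [e eP] := idempotentP luA [:: a]; have [ea _] := eP a (mem_head _ _).
pose P := left_proj e luA.
(* The functional w |-> h(w(e)) on the dual of Ae is evaluation at some [c0]. For the homomorphism x
   |-> x(au) this reads h(au) = (c0 a)u. *)
pose k : lhom (D P) (flip U) := lhom_comp h (ev_at U (left_gen e : P)).
have [c0 c0k] := (rU P).2.2 (to_dual luA uffU k).
have kE (w : hom_dual U P) : (val w : lhom P U) c0 = h ((val w :
  lhom P U) (left_gen e)).
  by have := congr1 val c0k => /(congr1 (fun h => lhom_fun h w)).
exists ((val c0 : A) ** a) => u.
have := kE (to_dual luB ufU (point_hom luA e (a **: u))) => /=.
by rewrite idemP -!lactA ea => <-; rewrite lactA.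
Qed.

End ReflexiveBimodule.

(** * Injectivity by extension from submodules of finitely generated modules *)

Section InjectivityCriterion.
Variables (R : rngType) (lu : local_units R) (Q : lmod R) (uQ : unitary Q).

(** Partial homomorphisms are handled as graphs, so that Zorn's lemma applies to sets ordered by
    inclusion; here a total graph is turned back into a homomorphism. *)
Lemma functional_lhom (N : lmod R) (X : set (N * Q)) :
  (forall x y, X x -> X y -> X (x.1 - y.1, x.2 - y.2)) ->
  (forall r x, X x -> X (r **: x.1, r **: x.2)) ->
  (forall q, X (0, q) -> q = 0) -> (forall n, exists q, X (n, q)) ->
  exists h : lhom N Q, forall n q, X (n, q) -> h n = q.
Proof.
move=> XB XZ X0 /choice[h hP].
have Xf n q q' : X (n, q) -> X (n, q') -> q = q'.
  move=> Xq Xq'; apply/eqP; rewrite -subr_eq0; apply/eqP/X0.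
  by have := XB _ _ Xq Xq'; rewrite /= subrr.
have hB : zmod_morphism h by move=> x y; apply: (Xf _ _ _ (hP _));
  exact: (XB _ _ (hP x) (hP y)).
have hZ r x : h (r **: x) = r **: h x by apply: (Xf _ _ _ (hP _));
  exact: (XZ r _ (hP x)).
by exists (mk_lhom hB hZ) => n q; exact: Xf.
Qed.

(** A Baer criterion: a maximal partial extension of f along i is total, because at a missing x the
    hypothesis, used for the cyclic module Rx and its intersection with the domain, extends it
    further. *)
Lemma injective_criterion :
  (forall (N : fgmod R) (K : submod N) (f : lhom (submod_lmod K) Q),
     exists g : lhom N Q, forall k, g (val k) = f k) -> injective_module Q.
Proof.
move=> ext; split=> // M N i f uM uN iI.
pose good (X : set (N * Q)) :=
  [/\ forall x y, X x -> X y -> X (x.1 - y.1, x.2 - y.2),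
      forall r x, X x -> X (r **: x.1, r **: x.2),
      forall q, X (0, q) -> q = 0 & forall m, X (i m, f m)].
have good_graph : good [set x | exists m, x = (i m, f m)].
  split=> [_ _ [m ->] [m' ->]|r _ [m ->]|q [m []]|m]; last by exists m.
  - by exists (m - m'); rewrite !raddfB.
  - by exists (r **: m); rewrite !lhom_act.
  - by rewrite -(raddf0 i) => /iI <- ->; rewrite raddf0.
(* The empty set is admitted so that the empty chain has an upper bound. *)
have [|X [Xgood Xmax]] := @Zorn_bigcup (N * Q) (fun X => X = set0 \/ good X).
  move=> F FP Ftot;
    have [[X0 FX0 gX0]|nX] := pselect (exists2 X, F X & good X); last first.
    left; apply/seteqP; split=> // x [X FX Xx]; case: (FP X FX) => [E|gX].
      by move: Xx; rewrite E.
    by case: nX; exists X.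
  right; have gF X x : F X -> X x -> good X.
    by move=> FX Xx; case: (FP X FX) => // E; move: Xx; rewrite E.
  split.
  - move=> x y [X FX Xx] [Y FY Yy].
    have [XY|YX] := Ftot X Y FX FY.
      by exists Y => //; have [h _ _ _] := gF _ _ FY Yy; apply: h => //;
        exact: XY.
    by exists X => //; have [h _ _ _] := gF _ _ FX Xx; apply: h => //;
      exact: YX.
  - by move=> r x [X FX Xx]; exists X => //; have [_ h _ _] := gF _ _ FX Xx;
      exact: h.
  - by move=> q [X FX Xx]; have [_ _ h _] := gF _ _ FX Xx; exact: h.
  - by move=> m; exists X0 => //; have [_ _ _ h] := gX0; exact: h.
case: Xgood => [X0|[XB XZ X0 Xf]].
  case: (Xmax _ _ (or_intror good_graph)); rewrite X0; split=> // E.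
  by apply: (E (i 0, f 0)); exists 0.
have Xfun n q q' : X (n, q) -> X (n, q') -> q = q'.
  move=> Xq Xq'; apply/eqP; rewrite -subr_eq0; apply/eqP/X0.
  by have := XB _ _ Xq Xq'; rewrite /= subrr.
have X00 : X (0, 0) by have := Xf 0; rewrite !raddf0.
have XD x y : X x -> X y -> X (x.1 + y.1, x.2 + y.2).
  move=> Xx Xy; have := XB _ _ X00 Xy; rewrite !sub0r => /(XB _ _ Xx).
  by rewrite /= !opprK.
suff /(functional_lhom XB XZ X0)[h hX] : forall n, exists q, X (n, q).
  by exists h; apply/lhomP => m; exact: hX.
move=> x; apply: contrapT => nXx.
pose C : fgmod R := FGMod (@unitary_sub _ _ (cyc_sub x) lu uN)
  ((fg_subP _).2 (fg_cyc (cyc_id x lu uN))).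
pose domX : set C := [set c | exists q, X (val c, q)].
have dom0 : domX 0 by exists 0.
have domB c d : domX c -> domX d -> domX (c - d).
  by move=> [q Xq] [r Xr]; exists (q - r); exact: (XB _ _ Xq Xr).
have domZ r c : domX c -> domX (r **: c).
  by move=> [q Xq]; exists (r **: q); exact: (XZ r _ Xq).
pose K : submod C := SubMod dom0 domB domZ.
have [g0 g0X] : exists h :
  lhom (submod_lmod K) Q, forall n q, X (val (val n), q) -> h n = q.
  apply: (@functional_lhom (submod_lmod K) [set p | X (val (val p.1), p.2)]).
  - by move=> p q; exact: XB.
  - by move=> r p; exact: XZ.
  - by move=> q; exact: X0.
  - by move=> n; have := submod_valP n.
have [g gg0] := ext C K g0.
(* The sum of the partial homomorphism [X] and of [g], which agree on the intersection of their
   domains. *)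
pose Y : set (N * Q) :=
  [set p | exists n q (c : C), X (n, q) /\ p = (n + val c, q + g c)].
have XY p : X p -> Y p.
  by case: p => n q Xq; exists n, q, 0; split=> //; rewrite raddf0 !addr0.
apply: (Xmax Y); last first.
  right; split; last by move=> m; exact/XY/Xf.
  - move=> _ _ [n [q [c [Xq ->]]]] [n' [q' [c' [Xq' ->]]]].
    exists (n - n'), (q - q'), (c - c'); split; first exact: (XB _ _ Xq Xq').
    by rewrite !raddfB /= !opprD (addrACA n) (addrACA q).
  - move=> r _ [n [q [c [Xq ->]]]].
    exists (r **: n), (r **: q), (r **: c); split; first exact: (XZ r _ Xq).
    by rewrite lhom_act /= !lactDr.
  - move=> q0 [n [q [c [Xq [nc ->]]]]].
    (* From n + c = 0 it follows that c lies in the domain of [X] with value -q, and [g] takes the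
       same value there. *)
    have Xc : X (val c, - q).
      have := XB _ _ X00 Xq; rewrite /= !sub0r.
      by have -> : - n = val c by apply/eqP; rewrite eq_sym -addr_eq0 addrC -nc.
    have Kc : K c by exists (- q).
    by rewrite -[c]/(val (to_sub Kc)) gg0 (g0X _ (- q)) // subrr.
split=> [p|E]; first exact: XY.
apply: nXx; exists (g (to_sub (cyc_id x lu uN))); apply: E.
by exists 0, 0, (to_sub (cyc_id x lu uN)); rewrite !add0r.
Qed.

End InjectivityCriterion.

(** * Injectivity and cogeneration for a reflexive bimodule *)

Section ReflexiveMorita.
Variables (A B : rngType) (luA : local_units A) (luB : local_units B).
Variables (U : biact A B) (uU : unitary U) (ufU : unitary (flip U)).
Hypotheses (rU : reflexive_biact U) (rfU : reflexive_biact (flip U)).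

Lemma mu_img_injective (b : B) : idem b -> injective_module (mu_img U b).
Proof.
move=> ib; apply: (injective_criterion luA (@unitary_sub _ _ (mu_sub U b) luA
  uU)).
move=> N K f.
have fgK : fg_sub K := reflexive_fg_sub luA luB uU ufU rU rfU K.
pose f' : lhom (sub_fgmod luA fgK) U := lhom_comp (incl_hom (mu_sub U b)) f.
have [g gf] := reflexive_extension luA luB uU ufU rU rfU f'
  (incl_inj (K := K) : injective (incl_hom K : lhom (sub_fgmod luA fgK) N)).
(* Multiplication by b forces the extension into Ub; on K nothing changes, since [f] already takes
   values there. *)
have mg x : mu_sub U b (lhom_comp (mu U b) g x) by exists (g x).
exists (corestrict mg) => k; apply: val_inj => /=.
rewrite (_ : g (val k) = val (f k)).
  by apply/(mu_subP ib); exact: (@submod_valP _ _ (mu_sub U b)).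
exact: (congr1 (fun h : lhom (sub_fgmod luA fgK) U => h k) gf).
Qed.

Lemma reflexive_idem_fg_injective : idem_fg_injective U.
Proof. by move=> b ib; split; [exact: mu_img_fg|exact: mu_img_injective]. Qed.

(** On the cyclic submodule generated by a non-zero difference f(x) - g(x), separation gives a
    homomorphism to U that does not kill the generator; it takes values in some Ub, and injectivity
    of Ub extends it to M. *)
Lemma reflexive_cogenerating : idem_cogenerating U.
Proof.
split; first by have [b _] := idempotentP luB [::];
  exists (mu_img U b), b => //; exact: idemP.
  by move=> _ [b _ ->]; exact: (@unitary_sub _ _ (mu_sub U b)).
move=> M N f g uM uN fg.
have [x fgx] : exists x, f x <> g x.
  by apply: contrapT => /forallNP h; apply: fg; apply/lhomP => x;
    exact: contrapT.
pose y := f x - g x.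
pose C : fgmod A := FGMod (@unitary_sub _ _ (cyc_sub y) luA uM)
  ((fg_subP _).2 (fg_cyc (cyc_id y luA uM))).
pose c : C := to_sub (cyc_id y luA uM).
have nc : ~ zero_sub C c.
  move=> /(congr1 val) /= /eqP; rewrite subr_eq0 => /eqP; exact: fgx.
have [h [_ hc]] := separation luA rU nc.
have [b bP] := hom_absorb luB ufU h (fgmod_fg C).
have hb z : mu_sub U b (h z) by exists (h z) => //; exact: bP.
have [_ inj] := mu_img_injective (idemP b).
have [k kE] := inj C M (incl_hom (cyc_sub y)) (corestrict hb)
  (fgmod_unitary C) uM (@incl_inj _ _ (cyc_sub y)).
exists (mu_img U b), k; split; first by exists b => //; exact: idemP.
move=> E; apply: hc;
  have := congr1 (fun h : lhom _ _ => h c) kE => /= /(congr1 val) /= <-.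
rewrite raddfB;
  have -> : k (f x) = k (g x) by exact: (congr1 (fun h : lhom _ _ => h x) E).
by rewrite subrr.
Qed.

End ReflexiveMorita.

(** * Chain conditions and composition series *)

Lemma ascending_submod (R : rngType) (M : lmod R) (c : nat -> submod M) :
  (forall n, c n `<=` c n.+1) -> (forall N : submod M, fg_sub N) ->
  exists n, c n.+1 `<=` c n.
Proof.
move=> cS noeth.
have cle m n : (m <= n)%N -> c m `<=` c n.
  by move=> /subnK <-; elim: (n - m)%N => // k IH; rewrite addSn;
    apply: subset_trans (cS _).
pose S : set M := [set x | exists n, c n x].
have S0 : S 0 by exists 0%N; exact: submod0.
have SB x y : S x -> S y -> S (x - y).
  move=> [m cx] [n cy]; exists (maxn m n); apply: submodB.
    exact: cle (leq_maxl _ _) _ cx.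
  exact: cle (leq_maxr _ _) _ cy.
have SZ r x : S x -> S (r **: x) by move=> [n cx]; exists n; exact: submod_act.
(* The union of the chain is finitely generated, so its generators all lie in one term. *)
have [s [sS Ss]] := noeth (SubMod S0 SB SZ).
have [n nP] : exists n, forall x, x \in s -> c n x.
  elim: s sS {Ss} => [|x s IH] sS; first by exists 0%N.
  have [y ys|m mP] := IH; first by apply: sS; rewrite inE ys orbT.
  have [n cx] := sS x (mem_head _ _).
  exists (maxn m n) => y; rewrite inE => /orP[/eqP ->|ys].
    exact: cle (leq_maxr _ _) _ cx.
  exact: cle (leq_maxl _ _) _ (mP y ys).
exists n => x cx; have := Ss x (ex_intro _ n.+1 cx); exact.
Qed.

(** Without a maximal element, choice would produce a strictly ascending chain. *)
Lemma maximal_submod (R : rngType) (M : lmod R) (P : submod M -> Prop) :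
  (forall N : submod M, fg_sub N) -> (exists K, P K) ->
  exists2 K, P K & forall L, P L -> K `<=` L -> L `<=` K.
Proof.
move=> noeth [K0 PK0]; apply: contrapT => nmax.
have /choice[next nextP] : forall K : {K | P K}, exists L : {K | P K},
    sval K `<=` sval L /\ ~ sval L `<=` sval K.
  move=> [K PK] /=; apply: contrapT => /forallNP h; apply: nmax;
    exists K => // L PL KL.
  by apply: contrapT => LK; apply: (h (exist _ L PL)).
pose c n := sval (iter n next (exist _ K0 PK0)).
have [|n] := @ascending_submod _ _ c _ noeth; first by move=> n;
  case: (nextP (iter n next (exist _ K0 PK0))).
by case: (nextP (iter n next (exist _ K0 PK0))).
Qed.

(** A submodule K maximal among those reached by a composition series is all of M: otherwise a
    submodule minimal among those strictly above K would prolong the series. *)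
Lemma finite_lengthP (R : rngType) (M : lmod R) :
  (forall N : submod M, fg_sub N) ->
  (forall P : submod M -> Prop, (exists K, P K) ->
     exists2 K, P K & forall L, P L -> L `<=` K -> K `<=` L) ->
  finite_length M.
Proof.
move=> noeth artin.
pose series n (c : nat -> submod M) (K : submod M) :=
  [/\ c 0%N = [set 0] :> set M,
  c n = K & forall i, (i < n)%N -> c i `<` c i.+1 /\
    forall N : submod M, c i `<=` N -> N `<=` c i.+1 ->
      N = c i :> set M \/ N = c i.+1 :> set M].
have [|K [n [c [c0 cn cS]]] Kmax] := @maximal_submod _ _ (fun K =>
  exists n c, series n c K) noeth.
  by exists (zero_sub M), 0%N, (fun=> zero_sub M).
have [KT|KT] := pselect (K = setT :> set M); first by exists n, c; split=> //;
  rewrite cn.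
have [|L [KL LK] Lmin] := artin (fun L : submod M => K `<` L).
  by exists (full_sub M); split=> // TK; apply: KT; apply/seteqP; split.
case: (LK); apply: Kmax => //.
exists n.+1, (fun i => if (i <= n)%N then c i else L); split=> //;
  first by rewrite ltnn.
move=> i; rewrite ltnS => lein; have [->|ne] := eqVneq i n; last first.
  have ltin : (i < n)%N by rewrite ltn_neqAle ne.
  by rewrite lein ltin; exact: cS.
rewrite leqnn ltnn cn; split=> // N KN NL.
have [NK|NK] := pselect (N `<=` K); first by left; apply/seteqP.
by right; apply/seteqP; split=> //; exact: Lmin.
Qed.

Theorem reflexive_locally_finite (A B : rngType) (U : biact A B) :
  local_units A -> local_units B -> unitary U -> unitary (flip U) ->
  reflexive_biact U -> reflexive_biact (flip U) -> left_locally_finite A.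
Proof.
move=> luA luB uU ufU rU rfU M; apply: finite_lengthP => [N|P [K0 PK0]].
  exact: (reflexive_fg_sub luA luB uU ufU rU rfU N).
pose D := dual_obj luB (fun M => (rU M).1) M.
(* A member of [P] with maximal annihilator is minimal in [P], because annihilators reverse
   inclusions and, by [annih_le], detect them. *)
have [||X [K [PK ->]] Xmax] := @maximal_submod _ D (fun X =>
  exists K, P K /\ X = annih U K).
- have [uffU rffU] : unitary (flip (flip U)) /\ reflexive_biact (flip (flip U)).
    by rewrite flip_flip.
  by move=> N; exact: (@reflexive_fg_sub _ _ luB luA _ ufU uffU rfU rffU D N).
- by exists (annih U K0), K0.
exists K => // L PL LK; apply: (annih_le luA luB ufU rU).
by apply: Xmax; [exists L|move=> w wK y /LK; exact: wK].
Qed.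

(* [morita_duality_bimodule] without the requirement that the second ring be
   presented as a converse ring, so that it applies to [flip U] too. *)
Definition morita_biact (A B : rngType) (U : biact A B) : Prop :=
  [/\ unitary U /\ unitary (flip U),
      idem_fg_injective U /\ idem_fg_injective (flip U),
      idem_cogenerating U /\ idem_cogenerating (flip U) &
      half_balanced U /\ half_balanced (flip U)].

Lemma morita_flip (A B : rngType) (U : biact A B) :
  morita_biact U -> morita_biact (flip U).
Proof. by rewrite /morita_biact flip_flip => -[[? ?] [? ?] [? ?] [? ?]]. Qed.

Theorem reflexive_morita (A B : rngType) (U : biact A B) :
  local_units A -> local_units B -> unitary U -> unitary (flip U) ->
  reflexive_biact U -> reflexive_biact (flip U) -> morita_biact U.
Proof.
move=> luA luB uU ufU rU rfU.
have uffU : unitary (flip (flip U)) by rewrite flip_flip.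
have rffU : reflexive_biact (flip (flip U)) by rewrite flip_flip.
split=> //; split.
- exact: reflexive_idem_fg_injective.
- exact: reflexive_idem_fg_injective.
- exact: reflexive_cogenerating.
- exact: reflexive_cogenerating.
- rewrite -[U]flip_flip; exact: reflexive_half_balanced.
- exact: reflexive_half_balanced.
Qed.

(** * Morita duality bimodules over a locally finite ring are reflexive *)

Section FiniteLength.
Variables (R : rngType) (M : lmod R).

(** Along a composition series the intersection with N gains at most one generator per step, because
    an element of N in [c i.+1] but not in [c i] generates [c i.+1] modulo [c i]. *)
Lemma finite_length_fg_sub (N : submod M) : finite_length M -> fg_sub N.
Proof.
move=> [n [c [c0 cn cS]]].
suff H i : (i <= n)%N -> fg_sub (cap_sub N (c i)).
  have -> : N = cap_sub N (c n); last exact: H.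
  by apply: submodP; rewrite /= cn setIT.
elim: i => [_|i IH ltin].
  exists [::]; split=> // x [_]; rewrite c0 => ->; exact: submod0.
have [[ci ciS] cmax] := cS i ltin; have [s [sN Ns]] := IH (ltnW ltin).
have [NS|/existsNP[x /not_implyP[[Nx cx] ncx]]] :=
  pselect (cap_sub N (c i.+1) `<=` c i).
  exists s; split=> [x /sN[Nx cx]|x [Nx cx]]; first by split=> //; exact: ci.
  by apply: Ns; split=> //; apply: NS.
have sN' y : y \in x :: s -> cap_sub N (c i.+1) y.
  rewrite inE => /orP[/eqP -> //|/sN[Ny cy]]; split=> //; exact: ci.
have span_le := sub_span sN'.
exists (x :: s); split=> // y [Ny cy].
have ss z : span_sub s z -> span_sub (x :: s) z.
  by move=> sz K sK; apply: sz => w ws; apply: sK; rewrite inE ws orbT.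
have [||E|E] := cmax (add_sub (c i) (span_sub (x :: s))).
- by move=> z cz; exists z, 0; rewrite addr0; split=> //; exact: submod0.
- move=> _ [k [l [ck /span_le[_ cl] ->]]]; apply: submodD => //; exact: ci.
- case: ncx; rewrite -[X in X x]E; exists 0, x; rewrite add0r; split=> //.
    exact: submod0.
  by apply: mem_span; rewrite mem_head.
have : submod_set (c i.+1) y by [].
rewrite -[X in X y]E => -[k [l [ck sl yE]]]; rewrite yE.
(* Modular law: [l] belongs to N, hence so does [k = y - l], which lies in [c i]. *)
apply: submodD => //; apply/ss/Ns; split=> //.
have -> : k = y - l by rewrite yE addrK.
by apply: submodB => //; case: (span_le _ sl).
Qed.

(** Each step of the series costs at most one homomorphism g, chosen not to kill some x of [c i.+1]
    that [s] kills. A non-zero y of [c i.+1] killed by g and [s] would generate [c i.+1] modulo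
    [c i]; then x = k + l with k in [c i] and l in the span of y, so k = 0 and g(x) = 0. *)
Lemma finite_length_separating (V : lmod R) : finite_length M ->
  (forall x : M, (forall g : lhom M V, g x = 0) -> x = 0) ->
  exists s : seq (lhom M V), forall x, (forall g, g \in s -> g x = 0) -> x = 0.
Proof.
move=> [n [c [c0 cn cS]]] sep.
suff H i : (i <= n)%N -> exists s : seq (lhom M V), forall x, c i x ->
    (forall g, g \in s -> g x = 0) -> x = 0.
  have [s sP] := H n (leqnn n); exists s => x; apply: sP.
  by rewrite cn.
elim: i => [_|i IH ltin]; first by exists [::] => x; rewrite c0.
have [[ci _] cmax] := cS i ltin; have [s sP] := IH (ltnW ltin).
have [h|/existsNP[x /not_implyP[cx /not_implyP[sx x0]]]] :=
  pselect (forall x, c i.+1 x -> (forall g, g \in s -> g x = 0) -> x = 0).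
  by exists s.
have /existsNP[g gx] : ~ forall g : lhom M V, g x = 0 by move/sep.
exists (g :: s) => y cy gy; apply: contrapT => y0.
have [||E|E] := cmax (add_sub (c i) (span_sub [:: y])).
- by move=> z cz; exists z, 0; rewrite addr0; split=> //; exact: submod0.
- move=> _ [k [l [ck sl ->]]]; apply: submodD; first exact: ci.
  by apply: sl => w; rewrite inE => /eqP ->.
- apply: y0; apply: (sP y) => [|h hs]; last by apply: gy; rewrite inE hs orbT.
  rewrite -[X in X y]E; exists 0, y; rewrite add0r; split=> //.
    exact: submod0.
  by apply: mem_span; rewrite mem_head.
have : submod_set (c i.+1) x by [].
rewrite -[X in X x]E => -[k [l [ck sl xE]]].
have lK h : h \in g :: s -> h l = 0.
  move=> hs; apply: (sl (preim_sub h (zero_sub V))) => w.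
  by rewrite inE => /eqP ->; exact: gy.
have k0 : k = 0.
  apply: sP => // h hs; have -> : k = x - l by rewrite xE addrK.
  by rewrite raddfB sx // lK ?subr0 // inE hs orbT.
by apply: gx; rewrite xE k0 add0r; apply: lK; rewrite mem_head.
Qed.

End FiniteLength.

(** * Scalar coefficients from injectivity and balance *)

Section MoritaHalf.
Variables (A B : rngType) (luA : local_units A) (luB : local_units B).
Variables (U : biact A B).
Hypothesis ufU : unitary (flip U).

(** Composed with multiplication by b, f becomes an endomorphism in (Im mu)(End U), hence
    multiplication by some c; on Ub multiplication by b is the identity. *)
Lemma half_balanced_hom (b : B) (f : lhom (mu_img U b) U) : half_balanced U ->
  idem b -> exists c, forall u, f u = biact_ract c (val u).
Proof.
move=> [_ /seteqP[bal _]] ib; have bU u : mu_sub U b (mu U b u) by exists u.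
pose h : lhom U U := lhom_comp f (corestrict bU).
have [|c _ cE] := bal (lhom_comp h (mu U b)); first by exists [:: (b, h)];
  rewrite big_seq1.
exists c => u;
  rewrite -[RHS](congr1 (fun k : lhom U U => k (val u)) (esym cE)) /=.
have bu : biact_ract b (val u) = val u.
  exact/(mu_subP ib)/(@submod_valP _ _ (mu_sub U b)).
by congr (lhom_fun f _); apply: val_inj; rewrite /= !bu.
Qed.

(** The [f i] embed M in a power of Ub, along which g extends by injectivity of Ub'; each component
    of the extension is a scalar by [half_balanced_hom]. *)
Lemma hom_combination (M : lmod A) n (f : 'I_n -> lhom M U) (g : lhom M U)
    (b b' : idempotent B) : idem_fg_injective U -> half_balanced U ->
      unitary M ->
  (forall i x, biact_ract b (f i x) = f i x) ->
  (forall x, biact_ract b' (g x) = g x) ->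
  (forall x, (forall i, f i x = 0) -> x = 0) ->
  exists c : 'I_n -> B, forall x, g x = \sum_i biact_ract (c i) (f i x).
Proof.
move=> inj bal uM fb gb f0.
have fbU i x : mu_sub U b (f i x) by apply/(mu_subP (idemP b)).
have gbU x : mu_sub U b' (g x) by apply/(mu_subP (idemP b')).
have [_ [_ injb']] := inj _ (idemP b').
have [_ [uUb _]] := inj _ (idemP b).
have [|k kE] := injb' _ _ (pow_tuple (fun i =>
  corestrict (@fbU i))) (corestrict gbU) uM
  (unitary_power n luA uUb).
  apply: lhom_injP => x /ffunP fx; apply: f0 => i.
  by have := congr1 val (fx i); rewrite !ffunE.
have /choice[c cE] i := half_balanced_hom
  (lhom_comp (incl_hom (mu_sub U b')) (lhom_comp k (pow_inj _ i))) bal (idemP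
    b).
exists c => x;
  transitivity (val (k (pow_tuple (fun i => corestrict (@fbU i)) x))).
  exact: (congr1 (fun h : lhom M (mu_img U b') => val (h x)) (esym kE)).
rewrite [X in k X]pow_sum raddf_sum (raddf_sum (incl_hom (mu_sub U b'))) /=.
apply: eq_bigr => i _; have := cE i (corestrict (@fbU i) x) => /= <-.
by rewrite ffunE.
Qed.

(** Distinct elements x and y give distinct homomorphisms from some Ae to M, which a homomorphism
    from M to some Ub tells apart. *)
Lemma cogenerating_ev_inj (M : fgmod A) : idem_cogenerating U ->
  injective (ev U (fgmod_unitary M)).
Proof.
move=> [_ _ cog] x y xy; apply: contrapT => nxy.
have [e [ex ey]] := unitary2 luA (fgmod_unitary M) x y.
have [|X [h [[b _ XE] hP]]] :=
  cog M (left_proj e luA) (point_hom luA e x) (point_hom luA e y)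
  (fgmod_unitary M) (fgmod_unitary (left_proj e luA)).
  by move=> /(congr1 (fun h : lhom _ _ => h (left_gen e)));
    rewrite !point_gen ex ey.
apply: hP; subst X; rewrite !comp_point; congr (point_hom luA e _).
apply: val_inj; have := congr1 val xy.
exact: (congr1 (fun k : lhom (hom_dual U M) (flip U) =>
  k (to_dual luB ufU (lhom_comp (incl_hom (mu_sub U b)) h)))).
Qed.

End MoritaHalf.

Section MoritaReflexive.
Variables (A B : rngType) (luA : local_units A) (luB : local_units B).
Variables (U : biact A B).
Hypotheses (uU : unitary U) (ufU : unitary (flip U)).

(** Evaluations at the generators of M have no common zero in the dual except 0, so k is a
    combination of them; its coefficients give the element of M. *)
Lemma morita_ev_surj (M : fgmod A) : idem_fg_injective (flip U) ->
  half_balanced (flip U) -> finitely_generated (hom_dual U M) ->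
  forall k, exists x, ev U (fgmod_unitary M) x = k.
Proof.
move=> inj bal fgD k; have [s sP] := (fgP M).1 (fgmod_fg M).
have [e eP] := unitary_seq luA (fgmod_unitary M) s.
have uffU : unitary (flip (flip U)) by rewrite flip_flip.
have [e' e'P] := hom_absorb luA uffU (val k : lhom (hom_dual U M) (flip U)) fgD.
have [|| c cE] := @hom_combination _ _ luB (flip U) (hom_dual U M) (size s)
  (fun i => ev_at U (tnth (in_tuple s) i)) (val k) e e' inj bal (unitary_upart
    _ luB) _ e'P.
- move=> i w; apply: etrans (esym (lhom_act (val w : lhom M U) e _)) _.
  by rewrite eP // mem_tnth.
- move=> w w0; apply: val_inj;
    apply: (lhom_eq_span sP) => x /(tnthP (in_tuple s))[i ->].
  exact: w0.
exists (\sum_i (c i) **: tnth (in_tuple s) i); apply: val_inj; apply/lhomP => w.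
rewrite cE /= raddf_sum; apply: eq_bigr => i _.
exact: (lhom_act (val w : lhom M U)).
Qed.

(** Finite length leaves finitely many homomorphisms to U with common kernel 0, and by
    [hom_combination] they generate the dual. *)
Lemma morita_dual_fg (M : fgmod A) : finite_length M -> idem_cogenerating U ->
  idem_fg_injective U -> half_balanced U -> finitely_generated (hom_dual U M).
Proof.
move=> flM cog inj bal.
have [x x0|s sP] := @finite_length_separating A M U flM.
  apply: (cogenerating_ev_inj luA luB ufU (M := M) cog); rewrite raddf0.
  by apply: val_inj; apply/lhomP => w; exact: x0.
have uD : unitary (hom_dual U M) := unitary_upart _ luB.
pose t := [seq to_dual luB ufU g | g <- s].
have [b bP] := unitary_seq luB uD t.
apply/fgP; exists t => w.
have [b' b'P] := hom_absorb luB ufU (val w : lhom M U) (fgmod_fg M).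
have [|| c cE] :=
  @hom_combination _ _ luA U M (size s) (tnth (in_tuple s)) (val w) b b'
  inj bal (fgmod_unitary M) _ b'P.
- move=> i x; have /bP : to_dual luB ufU (tnth (in_tuple s) i) \in t.
    by rewrite map_f // mem_tnth.
  by move=> /(congr1 val) /(congr1 (fun h : lhom M U => h x)).
- by move=> x x0; apply: sP => g /(tnthP (in_tuple s))[i ->].
have -> : w = \sum_i (c i) **: to_dual luB ufU (tnth (in_tuple s) i).
  apply: val_inj; apply/lhomP => x; rewrite cE.
  by rewrite -[RHS]/(ev_at U x (\sum_i (c i) **: _)) raddf_sum.
by apply: submod_sum => i; apply/submod_act/mem_span/map_f; rewrite mem_tnth.
Qed.

Definition dual_at (N : lmod B) (y : N) : lhom (hom_dual (flip U) N) U :=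
  @mk_lhom A (hom_dual (flip U) N) U (fun k => (val k : lhom N (flip U)) y)
    (fun _ _ => erefl) (fun _ _ => erefl).

(** No chain condition over B is at hand. Instead, values at the generators of N embed its dual in a
    power of Ub, a finitely generated A-module, hence of finite length. *)
Lemma morita_dual_fg_flip (N : fgmod B) : left_locally_finite A ->
  idem_fg_injective U -> finitely_generated (hom_dual (flip U) N).
Proof.
move=> llf inj; have [s sP] := (fgP N).1 (fgmod_fg N).
have [b bP] := unitary_seq luB (fgmod_unitary N) s.
have [fgUb [uUb _]] := inj b (idemP b).
pose P := FGMod (unitary_power (size s) luA uUb) (fg_power (size s) fgUb).
have tb (i : 'I_(size s)) k : mu_sub U b (dual_at (tnth (in_tuple s) i) k).
  apply/(mu_subP (idemP b)).
  apply: etrans (esym (lhom_act (val k : lhom N (flip U)) b _)) _.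
  by rewrite bP // mem_tnth.
apply: (@fg_sub_inj _ _ P (pow_tuple (fun i => corestrict (tb i)))); last first.
  exact/finite_length_fg_sub/llf.
apply: lhom_injP => k /ffunP k0; apply: val_inj; apply: (lhom_eq_span sP) => y.
by move=> /(tnthP (in_tuple s))[i ->]; have := congr1 val (k0 i);
  rewrite !ffunE.
Qed.

End MoritaReflexive.

Theorem morita_reflexive (A B : rngType) (U : biact A B) : local_units A ->
  local_units B -> left_locally_finite A -> morita_biact U ->
  reflexive_biact U /\ reflexive_biact (flip U).
Proof.
move=> luA luB llf [[uU ufU] [inj injf] [cog cogf] [bal balf]].
have uffU : unitary (flip (flip U)) by rewrite flip_flip.
split=> M; split.
- exact: morita_dual_fg.
- split; first exact: cogenerating_ev_inj.
  by apply: morita_ev_surj => //; exact: morita_dual_fg.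
- exact: morita_dual_fg_flip.
- split; first exact: cogenerating_ev_inj.
  by apply: morita_ev_surj; rewrite ?flip_flip //; exact: morita_dual_fg_flip.
Qed.

(** * The bimodule of a duality *)

Section FullyFaithful.
Variables (A B : rngType) (F : contrafunctor A B) (G : contrafunctor B A).

Lemma unit_iso_faithful M N : unit_iso F G -> injective (@cf_map A B F M N).
Proof.
move=> [eta [etaI etaN]] f g fg; apply/lhomP => x.
have /lhom_isoP[inj _] := etaI N; apply: inj.
have := etaN M N f; rewrite fg -etaN => /(congr1 (fun h : lhom _ _ => h x)).
exact.
Qed.

(** Conjugating G(g) by the unit gives f with G(F(f)) = G(g), and G is faithful. *)
Lemma duality_full M N (g : lhom (F N) (F M)) : duality F G ->
  exists f : lhom M N, cf_map F f = g.
Proof.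
move=> [[eta [etaI etaN]] [eta' [eta'I eta'N]]].
exists (lhom_comp (linv (etaI N)) (lhom_comp (cf_map G g) (eta M))).
set f := lhom_comp _ _.
have gG : injective (@cf_map B A G (F N) (F M)).
  move=> h k hk; apply/lhomP => x; have /lhom_isoP[inj _] := eta'I (F M);
    apply: inj.
  have := eta'N _ _ h; rewrite hk -eta'N => /(congr1 (fun h : lhom _ _ => h x)).
  exact.
apply: gG; apply/lhomP => y; have /lhom_isoP[_ /(_ y)[x <-]] := etaI M.
have := congr1 (fun h : lhom _ _ => h x) (etaN _ _ f) => /= <-.
by rewrite linvKV.
Qed.

End FullyFaithful.

Lemma cf_mapB (A B : rngType) (F : contrafunctor A B) (M N : fgmod A) (f g :
  lhom M N) :
  cf_map F (f - g) = cf_map F f - cf_map F g.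
Proof. by apply: (addIr (cf_map F g)); rewrite -cf_add !subrK. Qed.

Lemma cf_map0 (A B : rngType) (F : contrafunctor A B) (M N : fgmod A) :
  cf_map F (0 : lhom M N) = 0.
Proof. by rewrite -(subrr (0 : lhom M N)) cf_mapB subrr. Qed.

Section DualityBimodule.
Variables (A B : rngType) (luA : local_units A) (luB : local_units B).
Variable F : contrafunctor A B.

Let P e : fgmod A := left_proj e luA.

Lemma cf_point e (M N : fgmod A) (t : lhom M N) x w :
  cf_map F (point_hom luA e x : lhom (P e) M) (cf_map F t w) =
  cf_map F (point_hom luA e (t x) : lhom (P e) N) w.
Proof. by rewrite -comp_point cf_comp. Qed.

(** The ambient group, with no compatibility between components; the families that form the bimodule
    are cut out by [germ_sub]. *)
Definition idem_family : Type := forall e : idempotent A, F (left_proj e luA).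
HB.instance Definition _ := gen_eqMixin idem_family.
HB.instance Definition _ := gen_choiceMixin idem_family.

Let fzero : idem_family := fun=> 0.
Let fadd (u v : idem_family) : idem_family := fun e => u e + v e.
Let fopp (u : idem_family) : idem_family := fun e => - u e.
Let faddA : associative fadd.
Proof.
by move=> u v w; apply: functional_extensionality_dep => e; exact: addrA.
Qed.
Let faddC : commutative fadd.
Proof.
by move=> u v; apply: functional_extensionality_dep => e; exact: addrC.
Qed.
Let fadd0 : left_id fzero fadd.
Proof.
by move=> u; apply: functional_extensionality_dep => e; exact: add0r.
Qed.
Let faddN : left_inverse fzero fopp fadd.
Proof.
by move=> u; apply: functional_extensionality_dep => e; exact: addNr.
Qed.
HB.instance Definition _ :=
  GRing.isZmodule.Build idem_family faddA faddC fadd0 faddN.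

Lemma idem_familyP (u v : idem_family) : (forall e, u e = v e) -> u = v.
Proof. exact: functional_extensionality_dep. Qed.

Let fact (b : B) (u : idem_family) : idem_family := fun e => b **: u e.
Let factA r s x : fact (r ** s) x = fact r (fact s x).
Proof. by apply: idem_familyP => e; exact: lactA. Qed.
Let factDl r s x : fact (r + s) x = fact r x + fact s x.
Proof. by apply: idem_familyP => e; exact: lactDl. Qed.
Let factDr r x y : fact r (x + y) = fact r x + fact r y.
Proof. by apply: idem_familyP => e; exact: lactDr. Qed.
Definition idem_family_mod : lmod B := LMod factA factDl factDr.

Definition germ (M : fgmod A) (w : F M) (x : M) : idem_family :=
  fun e => cf_map F (point_hom luA e x : lhom (P e) M) w.

Lemma germ_comp (M N : fgmod A) (t : lhom M N) w x :
  germ (cf_map F t w) x = germ w (t x).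
Proof. by apply: idem_familyP => e; exact: cf_point. Qed.

Lemma germD (M : fgmod A) (w : F M) x y : germ w (x + y) = germ w x + germ w y.
Proof. by apply: idem_familyP => e; rewrite /germ pointD cf_add. Qed.

Lemma germB (M : fgmod A) (w : F M) x y : germ w (x - y) = germ w x - germ w y.
Proof. by apply: idem_familyP => e; rewrite /germ pointB cf_mapB. Qed.

Lemma germBl (M : fgmod A) (v w : F M) x : germ (v - w) x = germ v x - germ w x.
Proof. by apply: idem_familyP => e; rewrite /germ raddfB. Qed.

Lemma germZ (M : fgmod A) (w : F M) b x : germ (b **: w) x = fact b (germ w x).
Proof. by apply: idem_familyP => e; rewrite /germ lhom_act. Qed.

(** Moves a germ on any module to the generator of Af, so that germs of different origin can be
    compared on one module. *)
Lemma germ_proj (M : fgmod A) (w : F M) x (f : idempotent A) : f **: x = x ->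
  germ w x = germ (cf_map F (point_hom luA f x : lhom (P f) M) w) (left_gen f).
Proof. by move=> fx; rewrite germ_comp point_gen fx. Qed.

Let germs : set idem_family_mod :=
  [set u | exists (f : idempotent A) (v : F (P f)),
  u = germ v (left_gen f)].

Let germs_germ (M : fgmod A) (w : F M) x : germs (germ w x).
Proof.
by have [f fx] := unitary1 luA (fgmod_unitary M) x; rewrite (germ_proj _ fx);
  exists f; eexists.
Qed.
Let germs0 : germs 0.
Proof.
have [e _] := idempotentP luA [::].
suff -> : 0 = germ (0 : F (P e)) 0 :> idem_family by exact: germs_germ.
by apply: idem_familyP => f; rewrite /germ raddf0.
Qed.
Let germsB u v : germs u -> germs v -> germs (u - v).
Proof.
move=> [e [x ->]] [f [y ->]].
(* Both germs are moved to Ag for a common unit g of e and f, where they can be subtracted. *)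
have [g gP] := idempotentP luA [:: (e : A); (f : A)].
have ge : g **: left_gen e = left_gen e.
  by apply: val_inj; rewrite /= rmulA (gP (idem_val e) _).1 ?mem_head.
have gf : g **: left_gen f = left_gen f.
  by apply: val_inj; rewrite /= rmulA (gP (idem_val f) _).1 // !inE eqxx orbT.
by rewrite (@germ_proj (P e) _ _ _ ge) (@germ_proj (P f) _ _ _ gf) -germBl;
  exact: germs_germ.
Qed.
Let germsZ b u : germs u -> germs (b **: u).
Proof. by move=> [e [x ->]]; exists e, (b **: x); rewrite germZ. Qed.
Definition germ_sub : submod idem_family_mod := SubMod germs0 germsB germsZ.

Let UB : lmod B := submod_lmod germ_sub.

Definition Germ (M : fgmod A) (w : F M) x : UB :=
  @to_sub _ _ germ_sub _ (germs_germ w x).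

Lemma Germ_actr (M : fgmod A) b (w : F M) x : Germ (b **: w) x = b **: Germ w x.
Proof. by apply: val_inj; exact: germZ. Qed.

Lemma Germ_comp (M N : fgmod A) (t : lhom M N) w x :
  Germ (cf_map F t w) x = Germ w (t x).
Proof. by apply: val_inj; exact: germ_comp. Qed.

Lemma GermP (u : UB) : exists (f : idempotent A) (v :
  F (left_proj f luA)), u = Germ v (left_gen f).
Proof. by have [f [v uE]] := submod_valP u; exists f, v; apply: val_inj. Qed.

Let unit_for (a : A) : idempotent A := sval (cid (idempotentP luA [:: a])).
Let unit_forP a : a ** unit_for a = a.
Proof.
by rewrite /unit_for; case: cid => e /= eP; case: (eP a (mem_head _ _)).
Qed.

(** With f an idempotent such that af = a, the component of au at e is the image of the component of
    u at f under F of right multiplication by a, a map from Ae to Af. *)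
Let uact0 (a : A) (u : idem_family) : idem_family := fun e =>
  cf_map F (point_hom luA e (left_elt (unit_for a) a) :
    lhom (P e) (P _)) (u (unit_for a)).
Let uact0_germ a M (w : F M) x : uact0 a (germ w x) = germ w (a **: x).
Proof.
by apply: idem_familyP => e; rewrite /uact0 /germ cf_point /= unit_forP.
Qed.
Let uact_subproof a (u : UB) : germ_sub (uact0 a (val u)).
Proof.
by have [f [v ->]] := GermP u; rewrite /= uact0_germ; exact: germs_germ.
Qed.
Let uact a (u : UB) : UB := to_sub (uact_subproof a u).
Let uact_Germ a M (w : F M) x : uact a (Germ w x) = Germ w (a **: x).
Proof. by apply: val_inj; rewrite /= uact0_germ. Qed.
Let uactA r s x : uact (r ** s) x = uact r (uact s x).
Proof. by have [f [v ->]] := GermP x; rewrite !uact_Germ lactA. Qed.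
Let uactDl r s x : uact (r + s) x = uact r x + uact s x.
Proof.
have [f [v ->]] := GermP x; rewrite !uact_Germ lactDl; apply: val_inj;
  exact: germD.
Qed.
Let uactDr r x y : uact r (x + y) = uact r x + uact r y.
Proof. by apply: val_inj; apply: idem_familyP => e; exact: raddfD. Qed.
Let uactC a b (x : UB) : b **: uact a x = uact a (b **: x).
Proof.
by apply: val_inj; apply: idem_familyP => e; rewrite /= /uact0 /fact lhom_act.
Qed.

Definition duality_bimodule : biact A B :=
  @BiAct A B (LMod uactA uactDl uactDr) (@lact B UB) (@lactA B UB)
    (@lactDl B UB) (@lactDr B UB) uactC.

Local Notation U := duality_bimodule.

Definition Germ_hom (M : fgmod A) (w : F M) : lhom M U.
Proof.
apply: (@mk_lhom A M U (fun x => Germ w x)) => [x y|a x].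
  by apply: val_inj; exact: germB.
by symmetry; exact: uact_Germ.
Defined.

Lemma duality_bimodule_unitary : unitary U.
Proof.
apply: unitaryP => u; have [f [v ->]] := GermP u; exists f.
apply: etrans (esym (lhom_act (Germ_hom v) f _)) _; congr (Germ_hom v _).
by apply: val_inj; rewrite /= !idemP.
Qed.

Lemma duality_bimodule_unitary_flip : unitary (flip U).
Proof.
apply: unitaryP => u; have [f [v ->]] := GermP u.
have [b bv] := unitary1 luB (fgmod_unitary (F (P f))) v; exists b.
by apply: val_inj; rewrite /= -germZ bv.
Qed.
Let ufU := duality_bimodule_unitary_flip.

Definition Germ_dual (M : fgmod A) : lhom (F M) (hom_dual U M).
Proof.
apply: (@mk_lhom B (F M) (hom_dual U M) (fun w =>
  to_dual luB ufU (Germ_hom w))) => [v w|b w];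
  apply: val_inj; apply/lhomP => x; apply: val_inj;
    [exact: germBl|exact: germZ].
Defined.

Lemma Germ_dual_natural (M N : fgmod A) (f : lhom M N) :
  lhom_comp (Germ_dual M) (cf_map F f) = lhom_comp (hom_dual_map U f)
    (Germ_dual N).
Proof.
apply/lhomP => w; apply: val_inj; apply/lhomP => x; apply: val_inj;
  exact: germ_comp.
Qed.

(* Identifies [e U] with [F (A e)]. *)
Definition germ_component (e : idempotent A) :
  lhom (flip U) (F (left_proj e luA)) :=
  @mk_lhom B (flip U) (F (P e)) (fun u => (val u : idem_family) e)
    (fun _ _ => erefl) (fun _ _ => erefl).

(** An element of eU is the germ of its own component at e, taken at the generator of Ae. *)
Lemma germ_component_inj (e : idempotent A) (u v : U) : e **: u = u ->
  e **: v = v ->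
  germ_component e u = germ_component e v -> u = v.
Proof.
have H (w : U) : e **: w = w -> w = Germ (germ_component e w) (left_gen e).
  have [f [x ->]] := GermP w => ew; apply: val_inj; rewrite -[in LHS]ew.
  rewrite -[e **: _]/(uact e _) uact_Germ /=; apply: idem_familyP => g.
  by rewrite /germ cf_point point_gen.
by move=> /H {2}-> /H {2}-> ->.
Qed.

End DualityBimodule.

Lemma hom_dual_map_bij (A B : rngType) (U : biact A B) (M N : lmod A) (f :
  lhom M N) :
  lhom_bij f -> lhom_bij (hom_dual_map U f).
Proof.
move=> fb; have fi := (lhom_isoP f).2 fb; split=> [v w vw|w].
  apply: val_inj; apply/lhomP => y; rewrite -(linvKV fi y).
  exact: (congr1 (fun h : hom_dual U M => (val h : lhom M U) _) vw).
exists (hom_dual_map U (linv fi) w); apply: val_inj; apply/lhomP => x /=.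
by rewrite linvK.
Qed.

Lemma lhom_lift (R : rngType) (M N P : lmod R) (k : lhom N P) (h : lhom M P) :
  injective k -> (forall x, exists y, k y = h x) ->
  exists t : lhom M N, forall x, k (t x) = h x.
Proof.
move=> kI /choice[t tP].
have tB : zmod_morphism t by move=> x y; apply: kI; rewrite raddfB !tP raddfB.
have tZ r x : t (r **: x) = r **: t x by apply: kI;
  rewrite lhom_act !tP lhom_act.
by exists (mk_lhom tB tZ) => x; exact: tP.
Qed.

(** * Reflexivity of the bimodule of a duality *)

Section DualityReflexive.
Variables (A B : rngType) (luA : local_units A) (luB : local_units B).
Variables (F : contrafunctor A B) (G : contrafunctor B A) (dFG : duality F G).

Let U := duality_bimodule luA F.
Let uU : unitary U := duality_bimodule_unitary luA F.
Let ufU : unitary (flip U) := duality_bimodule_unitary_flip luA luB F.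
Let uffU : unitary (flip (flip U)).
Proof. by rewrite flip_flip. Qed.
Let faithful M N : injective (@cf_map A B F M N) := unit_iso_faithful dFG.1.

(** If all germs at x vanish, F kills the homomorphism from Ae that picks out x, and F is
    faithful. *)
Lemma Germ_faithful (M : fgmod A) (x : M) : (forall w :
  F M, Germ luA w x = 0) -> x = 0.
Proof.
move=> x0; have [e ex] := unitary1 luA (fgmod_unitary M) x.
have E : point_hom luA e x = 0 :> lhom (left_proj e luA) M.
  apply: faithful; rewrite cf_map0; apply/lhomP => w.
  exact: (congr1 (germ_component luA F e) (x0 w)).
by rewrite -ex -point_gen E.
Qed.

(** The values of g lie in some eU, so g amounts to a map from F(M) to F(Ae). By fullness this is
    F(t), and x is t(e). *)
Lemma Germ_full (M : fgmod A) (g : lhom (F M) (flip U)) :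
  exists x, forall w, g w = Germ luA w x.
Proof.
have [e eg] := hom_absorb luA uffU g (fgmod_fg (F M)).
have [t tE] := duality_full (lhom_comp (germ_component luA F e) g) dFG.
have et : e **: t (left_gen e) = t (left_gen e).
  by rewrite -lhom_act; congr (lhom_fun t _); apply: val_inj; rewrite /= !idemP.
exists (t (left_gen e)) => w; apply: (germ_component_inj (e := e));
  first exact: eg.
  by rewrite -[RHS]/(Germ_hom luA w _) -[in RHS]et lhom_act.
rewrite -[LHS](congr1 (fun h : lhom _ _ => h w) tE).
by rewrite /= /germ pointK.
Qed.

Section Generator.
Variables (b : idempotent B) (eta' :
  lhom (left_proj b luB) (F (G (left_proj b luB)))).
Hypothesis eta'I : lhom_iso eta'.
(** The germs of [eps] define [k], which proves injective with all of Ub in its image, so that G(Bb)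
    serves as a copy of Ub. *)
Let eps := eta' (left_gen b).
Let k : lhom (G (left_proj b luB)) U := Germ_hom luA eps.

(** By fullness, the map from F(G(Bb)) to F(M) that sends [eps] to w comes from some t. *)
Let factor (M : fgmod A) (w : F M) : b **: w = w ->
  exists t : lhom M (G (left_proj b luB)), w = cf_map F t eps.
Proof.
move=> bw; have [t tE] :=
  duality_full (lhom_comp (point_hom luB b w) (linv eta'I)) dFG.
by exists t;
  rewrite tE /= linvK -[RHS]/(point_hom luB b w (left_gen b)) point_gen bw.
Qed.

Lemma generator_inj : injective k.
Proof.
apply: lhom_injP => y y0; apply: Germ_faithful => w.
(* Every [w] is a multiple of [eps], whose germ at [y] vanishes. *)
have /lhom_isoP[_ /(_ w)[z <-]] := eta'I; rewrite -(left_gen_act z) lhom_act.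
by rewrite Germ_actr [Germ _ _ _]y0 lact0.
Qed.

(** The component of u at a suitable f is fixed by b, hence is F(t) applied to [eps]; the preimage
    is t(f). *)
Lemma generator_surj (u : U) : biact_ract b u = u -> exists y, k y = u.
Proof.
move=> bu; have [f [v uE]] := GermP u.
have fu : f **: u = u.
  rewrite uE; apply: etrans (esym (lhom_act (Germ_hom luA v) f _)) _.
  by congr (lhom_fun (Germ_hom luA v) _); apply: val_inj; rewrite /= !idemP.
have [t tE] : exists t : lhom (left_proj f luA) (G (left_proj b luB)),
    germ_component luA F f u = cf_map F t eps.
  by apply: factor; rewrite -lhom_act; congr (lhom_fun _ _).
exists (t (left_gen f)); apply: (germ_component_inj (e := f)) => //.
  by rewrite -lhom_act -lhom_act; congr (k (t _)); apply: val_inj;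
    rewrite /= !idemP.
by rewrite tE /= /germ pointK.
Qed.

Lemma generator_dual_surj (M : fgmod A) (h : lhom M U) :
  (forall x, biact_ract b (h x) = h x) ->
    exists w, forall x, h x = Germ luA w x.
Proof.
move=> bh; have [t tE] := lhom_lift generator_inj (fun x =>
  generator_surj (bh x)).
by exists (cf_map F t eps) => x; rewrite Germ_comp -tE.
Qed.

Lemma generator_dual_inj (M : fgmod A) (w : F M) : b **: w = w ->
  (forall x, Germ luA w x = 0) -> w = 0.
Proof.
move=> /factor[t ->] w0; have -> : t = 0; last by rewrite cf_map0.
apply/lhomP => x; apply: generator_inj; rewrite raddf0 /=.
by rewrite -Germ_comp.
Qed.

End Generator.

Lemma Germ_dual_bij (M : fgmod A) : lhom_bij (Germ_dual luA luB F M).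
Proof.
have [_ [eta' [eta'I _]]] := dFG; split=> [|h].
  apply: lhom_injP => w w0; have [b bw] := unitary1 luB (fgmod_unitary (F M)) w.
  apply: (generator_dual_inj (eta'I (left_proj b luB)) bw) => x.
  exact: (congr1 (fun h : hom_dual U M => (val h : lhom M U) x) w0).
have [b bh] := hom_absorb luB ufU (val h : lhom M U) (fgmod_fg M).
have [w wE] := generator_dual_surj (eta'I (left_proj b luB)) bh.
by exists w; apply: val_inj; apply/lhomP.
Qed.

(** Once F(M) is identified with the dual of M, injectivity and surjectivity of evaluation are
    [Germ_faithful] and [Germ_full]. *)
Lemma duality_bimodule_reflexive : reflexive_biact U.
Proof.
move=> M; have [gI gS] := Germ_dual_bij M; split.
  exact: fg_surj (fgmod_fg (F M)) gS.
split=> [|h].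
  apply: lhom_injP => x x0; apply: Germ_faithful => w.
  exact: (congr1 (fun h : hom_dual (flip U) (hom_dual U M) =>
    (val h : lhom (hom_dual U M) (flip U)) (Germ_dual luA luB F M w)) x0).
have [x xE] := Germ_full (lhom_comp (val h : lhom _ _) (Germ_dual luA luB F M)).
exists x; apply: val_inj; apply/lhomP => g; have [w <-] := gS g.
by rewrite -[RHS]/(lhom_comp (val h : lhom _ _) (Germ_dual luA luB F M) w) xE.
Qed.

Lemma duality_bimodule_iso : iso_hom_dual U F.
Proof.
exists (Germ_dual luA luB F); split; last exact: Germ_dual_natural.
by move=> M; apply/lhom_isoP; exact: Germ_dual_bij.
Qed.

Section Inverse.
Variable eta' : forall N : fgmod B, lhom N (F (G N)).
Hypothesis eta'I : forall N, lhom_iso (eta' N).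

Let to_dualF (N : fgmod B) : lhom N (hom_dual U (G N)) :=
  lhom_comp (Germ_dual luA luB F (G N)) (eta' N).
Let to_dualF_bij N : lhom_bij (to_dualF N).
Proof. by apply: lhom_bij_comp; [exact: Germ_dual_bij|exact/lhom_isoP]. Qed.

(** Evaluation sends G(N) to its double dual, and the dual of G(N) is F(G(N)), which is N. *)
Definition Germ_dual_inv (N : fgmod B) : lhom (G N) (hom_dual (flip U) N) :=
  lhom_comp (hom_dual_map (flip U) (to_dualF N)) (ev U (fgmod_unitary (G N))).

Lemma Germ_dual_inv_bij N : lhom_bij (Germ_dual_inv N).
Proof.
apply: lhom_bij_comp; first exact/hom_dual_map_bij/to_dualF_bij.
by case: (duality_bimodule_reflexive (G N)).
Qed.

Lemma duality_bimodule_reflexive_flip : reflexive_biact (flip U).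
Proof.
move=> N; have [psiI psiS] := Germ_dual_inv_bij N; split.
  exact: fg_surj (fgmod_fg (G N)) psiS.
(* Evaluation on N followed by the transpose of [Germ_dual_inv N] is [to_dualF N], read in the
   double flip of U; both this transpose and [to_dualF N] are bijective. *)
apply: (lhom_bij_cancel (hom_dual_map_bij (flip (flip U)) (Germ_dual_inv_bij
  N))).
have [dI dS] := to_dualF_bij N; split=> [|h].
  apply: lhom_injP => z z0; apply: dI; rewrite raddf0; apply: val_inj.
  apply/lhomP => y.
  exact: (congr1 (fun h : hom_dual (flip (flip U)) (G N) =>
    (val h : lhom (G N) (flip (flip U))) y) z0).
(* The same map, retyped with target U in place of its double flip. *)
pose h' : lhom (G N) U :=
  @mk_lhom A (G N) U (val h : lhom (G N) (flip (flip U)))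
  (raddfB (val h : lhom (G N) (flip (flip U))))
  (lhom_act (val h : lhom (G N) (flip (flip U)))).
have [z zE] := dS (to_dual luB ufU h'); exists z; apply: val_inj;
  apply/lhomP => y.
exact: (congr1 (fun h : hom_dual U (G N) => (val h : lhom (G N) U) y) zE).
Qed.

Hypothesis eta'N : forall (M N : fgmod B) (f : lhom M N),
  lhom_comp (eta' N) f = lhom_comp (cf_map F (cf_map G f)) (eta' M).

Lemma duality_bimodule_iso_flip : iso_hom_dual (flip U) G.
Proof.
exists Germ_dual_inv; split; first by move=> N; apply/lhom_isoP;
  exact: Germ_dual_inv_bij.
move=> M N f; apply/lhomP => y; apply: val_inj; apply/lhomP => z /=.
rewrite -[RHS]/(Germ luA (lhom_comp (eta' N) f z) y) eta'N.
by rewrite -[RHS]/(Germ luA (cf_map F _ _) y) Germ_comp.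
Qed.

End Inverse.
End DualityReflexive.

Theorem duality_reflexive (A B : rngType) (F : contrafunctor A B)
    (G : contrafunctor B A) :
  local_units A -> local_units B -> duality F G ->
  exists U : biact A B, [/\ unitary U, unitary (flip U),
    reflexive_biact U & reflexive_biact (flip U)]
    /\ iso_hom_dual U F /\ iso_hom_dual (flip U) G.
Proof.
move=> luA luB dFG; have [_ [eta' [eta'I eta'N]]] := dFG.
exists (duality_bimodule luA F); split; last first.
  by split; [exact: duality_bimodule_iso dFG|exact: duality_bimodule_iso_flip
    eta'N].
split.
- exact: duality_bimodule_unitary.
- exact: duality_bimodule_unitary_flip.
- exact: duality_bimodule_reflexive dFG.
- exact: duality_bimodule_reflexive_flip eta'I.
Qed.

(** * The equivalence and the form of the dualities *)

Theorem theoremC (R S : rngType) (hR : local_units R) (hS : local_units S) :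
  let a := exists (F : contrafunctor R S^c) (G : contrafunctor S^c R),
    duality F G in
  let b := left_locally_finite R /\
    exists U : bimodule R S, morita_duality_bimodule U in
  let c := right_locally_finite S /\
    exists U : bimodule R S, morita_duality_bimodule U in
  ((a <-> b) /\ (b <-> c)) /\
  (a ->
     (forall U : bimodule R S, morita_duality_bimodule U ->
        exists (F : contrafunctor R S^c) (G : contrafunctor S^c R),
          [/\ duality F G, iso_hom_dual U F & iso_hom_dual (flip U) G]) /\
     (forall (F : contrafunctor R S^c) (G : contrafunctor S^c R),
        duality F G ->
        exists U : bimodule R S,
          [/\ morita_duality_bimodule U,
              iso_hom_dual U F & iso_hom_dual (flip U) G])).
Proof.
move=> a b c; have hSc := local_units_conv hS.
have from_duality F G : duality F G -> exists U : bimodule R S,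
    [/\ morita_duality_bimodule U, left_locally_finite R,
      right_locally_finite S &
        iso_hom_dual U F /\ iso_hom_dual (flip U) G].
  move=> /(duality_reflexive hR hSc)[U [[uU ufU rU rfU] isoU]]; exists U;
    split=> //.
  - exact: reflexive_morita.
  - exact: reflexive_locally_finite rU rfU.
  - by apply: (reflexive_locally_finite (U := flip U)); rewrite ?flip_flip.
have ab : a -> b.
  by move=> [F [G /from_duality[U [mU llR _ _]]]]; split=> //; exists U.
have ac : a -> c.
  by move=> [F [G /from_duality[U [mU _ llS _]]]]; split=> //; exists U.
have to_duality U : left_locally_finite R -> morita_duality_bimodule U ->
    exists (F : contrafunctor R S^c) (G : contrafunctor S^c R),
      [/\ duality F G, iso_hom_dual U F & iso_hom_dual (flip U) G].
  by move=> llR /(morita_reflexive hR hSc llR)[rU rfU];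
    exact: reflexive_duality.
have ba : b -> a.
  by move=> [llR [U /(to_duality U llR)[F [G [dFG _ _]]]]]; exists F, G.
have ca : c -> a.
  (* Passing to [flip U] exchanges the rings, so local finiteness of the second ring is used as that
     of the first. *)
  move=> [llS [U /morita_flip mU]].
  have [rfU rffU] := morita_reflexive hSc hR llS mU; rewrite flip_flip in rffU.
  by have [F [G [dFG _ _]]] := reflexive_duality hR hSc rffU rfU; exists F, G.
split; first by split; [split=> [/ab|/ba]|split=> [/ba/ac|/ca/ab]].
move=> /ab[llR _]; split=> [U|F G]; first exact: to_duality.
by move=> /from_duality[U [mU _ _ [isoF isoG]]]; exists U.
Qed.
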